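(* Assume $U\in C^1([0,\alpha])$. Then: (i) For every $\rho^0\in\mathcal A_\Delta$ there exists $J^{\Delta,\infty}\rho^0:=\lim_{n\to\infty}(J^\Delta)^n\rho^0$. This limit is a fixed point of $J^\Delta$ (i.e. a constant-in-time solution). (ii) The operator $J^{\Delta,\infty}$ is an $L^1_\Delta$-contraction. Assume, furthermore, that $U''(s)>0$ for a.e. $s\in(0,\alpha)$. Let $M\in(0,\alpha|\Omega|)$ (here $\Omega=(0,1)$) and define $$\rho_i^{0,\infty}=T_{0,\alpha}\circ(U')^{-1}(C_0^\Delta-V(x_i)),\quad i\in I,$$ where $C_0^\Delta$ is determined by the mass condition $\Delta x\sum_iT_{0,\alpha}\circ(U')^{-1}(C_0^\Delta-V(x_i))=M$. Then: (iii) $\rho^{0,\infty}$ is a constant-in-time solution of $(P^\Delta)$, i.e. $J^\Delta\rho^{0,\infty}=\rho^{0,\infty}$. In particular, $J^{\Delta,\infty}\rho^{0,\infty}=\rho^{0,\infty}$. (iv) For the same mass $M$, let $\rho_i^{\varepsilon,\infty}=(U_\varepsilon')^{-1}(C_\varepsilon^\Delta-V(x_i))$ with $C_\varepsilon^\Delta$ uniquely determined by $\Delta x\sum_i(U_\varepsilon')^{-1}(C_\varepsilon^\Delta-V(x_i))=M$. Then $\rho^{\varepsilon,\infty}\to\rho^{0,\infty}$ as $\varepsilon\to0$. (v) Let $C_0$ be the constant uniquely determined by $\int_\Omega T_{0,\alpha}\circ(U')^{-1}(C_0-V)\,dx=M$. Then $C_0^\Delta\to C_0$ as $\Delta x\to0$.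 If moreover $\inf_{s\in(0,\alpha)}U''(s)>0$ and $(U')^{-1}\in C^\gamma([U'(0),U'(\alpha)])$, then $|C_0^\Delta-C_0|\le\mathsf C(\Delta x)^\gamma$ with $\mathsf C$ independent of $\Delta x$.
   Context: Setting. $\Omega=(0,1)$. Standing assumptions: (1) $\alpha\in(0,\infty)$, $\mathrm m\in C([0,\alpha])\cap C^1((0,\alpha))$, $\mathrm m(0)=\mathrm m(\alpha)=0$, $\mathrm m>0$ on $(0,\alpha)$; (2) $V\in C^2([0,1])$, $V\ge0$; (3) $U\in W^{1,1}((0,\alpha))\cap C^3((0,\alpha))$, $U''\ge0$, and $s_0\in(0,\alpha)$ is a fixed point with $U''(s_0)>0$; (4) $\mathrm m U''\in L^1(0,\alpha)$ and, with $\Phi(s):=\int_{s_0}^s\mathrm m(\tau)U''(\tau)\,d\tau$, one has $\Phi(0)<\Phi(s)<\Phi(\alpha)$ for $s\in(0,\alpha)$ and $$\sup_{s\in[0,\alpha]}\left|\tfrac{(\Phi(\alpha)-\Phi(s))\Phi(s)}{\Phi'(s)}\right|+\left|\tfrac{(\Phi(s)-\Phi(0))\Phi(s)}{\Phi'(s)}\right|<\infty .$$ With $\underline\zeta:=U'(0^+)$, $\overline\zeta:=U'(\alpha^-)$, $T_{0,\alpha}\circ(U')^{-1}(\zeta)$ equals $\alpha$ if $\zeta\ge\overline\zeta$, $(U')^{-1}(\zeta)$ if $\zeta\in(\underline\zeta,\overline\zeta)$, and $0$ if $\zeta\le\underline\zeta$. Regularisation, $\varepsilon\in(0,1]$. $\kappa(\varepsilon)>0$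 with $\kappa(\varepsilon)\to0$ as $\varepsilon\to0$. $\Phi_\varepsilon\in C^3([0,\alpha])$ satisfies $g_\varepsilon\le\Phi_\varepsilon'\le(1+\varepsilon)g_\varepsilon$, where $g_\varepsilon(s)=\min(\Phi'(s),\kappa(\varepsilon)^{-1})+\varepsilon$, $\Phi_\varepsilon(s_0)=0$, and $\Phi_\varepsilon\to\Phi$ in $C^2_{loc}((0,\alpha))$. $\mathrm m_\varepsilon\in C^1([0,\alpha])$ satisfies $\mathrm m_\varepsilon(0)=\mathrm m_\varepsilon(\alpha)=0$, $\mathrm m_\varepsilon>0$ in $(0,\alpha)$, $|\mathrm m_\varepsilon'|>1$ near $0$ and $\alpha$. $U_\varepsilon\in C^{3,1}((0,\alpha))$ is given by $U_\varepsilon''=\Phi_\varepsilon'/\mathrm m_\varepsilon$, $U_\varepsilon(\alpha/2)=U(\alpha/2)$, $U_\varepsilon'(\alpha/2)=U'(\alpha/2)$; consequently $U_\varepsilon':(0,\alpha)\to\mathbb R$ is a strictly increasing bijection. Moreover $\mathrm m_\varepsilon\to\mathrm m$ pointwise, $\sup_{\varepsilon\in(0,1)}\|U_\varepsilon'\|_{L^1((0,\alpha))}<\infty$, and $(\varepsilon,s)\mapsto\mathrm m_\varepsilon(s)$ (with $\mathrm m_0=\mathrm m$) belongs to $C([0,1]\times[0,\alpha])\cap C^\infty_{loc}((0,1]\times[0,\alpha])$. Decomposition of the mobility (assumed): $\mathrm m=\mathrm m^{(1)}\mathrm m^{(2)}$ with $\mathrm m^{(j)}:[0,\alpha]\to[0,\infty)$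 Lipschitz continuous, $\mathrm m^{(1)}$ non-decreasing, $\mathrm m^{(2)}$ non-increasing. Scheme $(P^\Delta)$. Let $N\in\mathbb N$, $I=\{1,\dots,N\}$, $\Delta x=1/N$, $\Delta t>0$, $x_i=(i-\frac12)\Delta x$, $\Delta=(\Delta t,\Delta x)$. Given $\rho^n$, $\rho^{n+1}$ solves, for $i\in I$, $$\frac{\rho_i^{n+1}-\rho_i^n}{\Delta t}=-\frac{F_{i+\frac12}(\rho^{n+1})-F_{i-\frac12}(\rho^{n+1})}{\Delta x},$$ $$F_{i+\frac12}(\rho)=\mathrm m^{(1)}(\rho_i)\mathrm m^{(2)}(\rho_{i+1})(v_{i+\frac12}(\rho))^++\mathrm m^{(1)}(\rho_{i+1})\mathrm m^{(2)}(\rho_i)(v_{i+\frac12}(\rho))^-,$$ $$v_{i+\frac12}(\rho)=-\frac{\xi_{i+1}(\rho)-\xi_i(\rho)}{\Delta x},\quad \xi_i(\rho)=U'(\rho_i)+V(x_i),\quad F_{\frac12}=F_{N+\frac12}=0,$$ with $u^+=\max(u,0)$, $u^-=\min(u,0)$. $\mathcal A_\Delta=\{\rho\in\mathbb R^{|I|}:0\le\rho_i\le\alpha\}$, $\|\rho\|_{L^1_\Delta}=\sum_{i\in I}|\rho_i|$. When $U\in C^1([0,\alpha])$, for each $\rho^0\in\mathcal A_\Delta$ the step has a unique solution $J^\Delta\rho^0:=\rho^1\in\mathcal A_\Delta$. *)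

(* Defs.v *)
From HB Require Import structures.
From mathcomp Require Import all_boot all_order all_algebra.
From mathcomp Require Import all_classical all_reals all_analysis.

Set Implicit Arguments.
Unset Strict Implicit.
Unset Printing Implicit Defensive.

Import Order.TTheory GRing.Theory Num.Theory.
Import numFieldNormedType.Exports.

Local Open Scope ring_scope.
Local Open Scope classical_set_scope.

(** * Regularity classes *)

Definition Ck_oo (R : realType) (k : nat) (a b : R) (f : R -> R) : Prop :=
  forall x : R, a < x < b ->
    (forall j, (j < k)%N -> derivable (f^`(j)) x 1) /\
    {for x, continuous (f^`(k))}.

(* C^k([a,b]): f is C^k inside, continuous on [a,b], and every derivative of
   order at most k extends continuously to [a,b].  No derivative of f is ever
   evaluated at a or b (where f^`(j) would see values of f outside [a,b]). *)
Definition Ck_cc (R : realType) (k : nat) (a b : R) (f : R -> R) : Prop :=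
  [/\ Ck_oo k a b f,
      {within `[a, b], continuous f} &
      forall j, (j <= k)%N ->
        exists2 g : R -> R, {within `[a, b], continuous g} &
                            forall x : R, a < x < b -> g x = (f^`(j)) x].

(* C^infty((0,1] x [0,alpha]): all mixed partial derivatives exist inside and
   extend continuously up to the parts of the boundary that belong to the set.
   [G j k] is the derivative of order j in e and k in s. *)
Definition Cinfty_strip (R : realType) (alpha : R) (f : R -> R -> R) : Prop :=
  exists G : nat -> nat -> R -> R -> R,
    [/\ forall e s : R, 0 < e <= 1 -> 0 <= s <= alpha -> G 0%N 0%N e s = f e s,
        forall j k, {within `]0, 1] `*` `[0, alpha],
                      continuous (fun p : R * R => G j k p.1 p.2)} &
        forall (j k : nat) (e s : R), 0 < e < 1 -> 0 < s < alpha ->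
          is_derive e 1 (fun e' => G j k e' s) (G j.+1 k e s) /\
          is_derive s 1 (G j k e) (G j k.+1 e s)].

Definition holder_on (R : realType) (gamma a b : R) (f : R -> R) : Prop :=
  exists K : R, forall x y : R, a <= x <= b -> a <= y <= b ->
    `|f x - f y| <= K * `|x - y| `^ gamma.

(* f' on (a,b), extended to the endpoints by its one-sided limits. *)
Definition deriv_cc (R : realType) (a b : R) (f : R -> R) (s : R) : R :=
  if s <= a then lim (f^`() x @[x --> a^'+])
  else if b <= s then lim (f^`() x @[x --> b^'-])
  else f^`() s.

(** * Standing assumptions *)

(* Phi(s) = \int_{s0}^s m U'', an oriented integral. *)
Definition Phi (R : realType) (m U : R -> R) (s0 s : R) : R :=
  if s0 <= s
  then \int[@lebesgue_measure R]_(t in `[s0, s]) (m t * (U^`(2))%classic t)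
  else - \int[@lebesgue_measure R]_(t in `[s, s0]) (m t * (U^`(2))%classic t).

(* The source also requires
     sup_[0,alpha] |(Phi alpha - Phi) Phi / Phi'| + |(Phi - Phi 0) Phi / Phi'|
   to be finite.  This is omitted on purpose.  As Phi 0 < 0 = Phi s0 and
   Phi 0 < Phi alpha, it forces Phi' = m U'' >= c > 0 near 0; the mobility
   decomposition gives m s <= L s, so U'' >= c / (L s) is not integrable near
   0, contradicting U in C^1([0,alpha]).  With that bound the hypotheses of the
   theorem would be inconsistent.  Leaving it out only generalises the result.

   U being C^3 inside, membership in W^{1,1}((0,alpha)) is integrability of U
   and of its classical derivative. *)
Record standing (R : realType) (alpha : R) (m V U : R -> R) (s0 : R)
    : Prop := Standing {
  st_alpha : 0 < alpha ;
  st_m_cont : {within `[0, alpha], continuous m} ;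
  st_m_C1 : Ck_oo 1 0 alpha m ;
  st_m_0 : m 0 = 0 ;
  st_m_alpha : m alpha = 0 ;
  st_m_pos : forall s : R, 0 < s < alpha -> 0 < m s ;
  st_V_C2 : Ck_cc 2 0 1 V ;
  st_V_ge0 : forall x : R, 0 <= x <= 1 -> 0 <= V x ;
  st_U_L1 : (@lebesgue_measure R).-integrable `]0, alpha[ (EFin \o U) ;
  st_dU_L1 : (@lebesgue_measure R).-integrable `]0, alpha[ (EFin \o U^`()) ;
  st_U_C3 : Ck_oo 3 0 alpha U ;
  st_U_convex : forall s : R, 0 < s < alpha -> 0 <= (U^`(2)) s ;
  st_s0 : 0 < s0 < alpha ;
  st_s0_pos : 0 < (U^`(2)) s0 ;
  st_mU_L1 : (@lebesgue_measure R).-integrable `]0, alpha[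
               (fun s : R => (m s * (U^`(2))%classic s)%:E) ;
  st_Phi : forall s : R, 0 < s < alpha ->
             Phi m U s0 0 < Phi m U s0 s < Phi m U s0 alpha
}.

Record mobility_decomposition (R : realType) (alpha : R) (m m1 m2 : R -> R)
    : Prop := MobilityDecomposition {
  md_prod : forall s : R, 0 <= s <= alpha -> m s = m1 s * m2 s ;
  md_m1_ge0 : forall s : R, 0 <= s <= alpha -> 0 <= m1 s ;
  md_m2_ge0 : forall s : R, 0 <= s <= alpha -> 0 <= m2 s ;
  md_m1_lip : [lipschitz m1 s | s in `[0, alpha]] ;
  md_m2_lip : [lipschitz m2 s | s in `[0, alpha]] ;
  md_m1_nondecr : forall s t : R, 0 <= s -> s <= t -> t <= alpha -> m1 s <= m1 t ;
  md_m2_nonincr : forall s t : R, 0 <= s -> s <= t -> t <= alpha -> m2 t <= m2 s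
}.

(** * The regularised problem *)

Definition g_eps (R : realType) (m U : R -> R) (s0 : R) (kappa : R -> R)
    (e s : R) : R :=
  Num.min ((Phi m U s0)^`() s) (kappa e)^-1 + e.

(* That each Ue e has a derivative which is an increasing bijection from
   (0,alpha) onto the reals follows from these fields. *)
Record regularisation (R : realType) (alpha : R) (m U : R -> R) (s0 : R)
    (kappa : R -> R) (Phie me Ue : R -> R -> R) : Prop := Regularisation {
  re_kappa_pos : forall e : R, 0 < e <= 1 -> 0 < kappa e ;
  re_kappa_cvg : kappa e @[e --> 0^'+] --> (0 : R) ;
  re_Phi_C3 : forall e : R, 0 < e <= 1 -> Ck_cc 3 0 alpha (Phie e) ;
  re_Phi_bounds : forall e s : R, 0 < e <= 1 -> 0 < s < alpha ->
    g_eps m U s0 kappa e s <= (Phie e)^`() s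
      <= (1 + e) * g_eps m U s0 kappa e s ;
  re_Phi_s0 : forall e : R, 0 < e <= 1 -> Phie e s0 = 0 ;
  re_Phi_cvg : forall a b : R, 0 < a -> a < b -> b < alpha ->
    forall j, (j <= 2)%N ->
      {uniform `[a, b], (fun e => (Phie e)^`(j)) @ 0^'+
                          --> (Phi m U s0)^`(j)} ;
  re_m_C1 : forall e : R, 0 < e <= 1 -> Ck_cc 1 0 alpha (me e) ;
  re_m_0 : forall e : R, 0 < e <= 1 -> me e 0 = 0 ;
  re_m_alpha : forall e : R, 0 < e <= 1 -> me e alpha = 0 ;
  re_m_pos : forall e s : R, 0 < e <= 1 -> 0 < s < alpha -> 0 < me e s ;
  re_m_slope : forall e : R, 0 < e <= 1 -> exists2 d : R, 0 < d &
    forall s : R, 0 <= s <= alpha -> s < d \/ alpha - d < s ->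
      1 < `|deriv_cc 0 alpha (me e) s| ;
  re_U_C31 : forall e : R, 0 < e <= 1 -> Ck_oo 3 0 alpha (Ue e) /\
    forall a b : R, 0 < a -> a < b -> b < alpha ->
      [lipschitz ((Ue e)^`(3)) s | s in `[a, b]] ;
  re_U_eq : forall e s : R, 0 < e <= 1 -> 0 < s < alpha ->
    ((Ue e)^`(2)) s = ((Phie e)^`())%classic s / me e s ;
  re_U_mid : forall e : R, 0 < e <= 1 -> Ue e (alpha / 2) = U (alpha / 2) ;
  re_dU_mid : forall e : R, 0 < e <= 1 ->
    (Ue e)^`() (alpha / 2) = U^`() (alpha / 2) ;
  re_m_cvg : forall s : R, 0 <= s <= alpha -> me e s @[e --> 0^'+] --> m s ;
  re_dU_bounded : exists K : R, forall e : R, 0 < e < 1 ->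
    (\int[@lebesgue_measure R]_(s in `]0%R, alpha[) `|((Ue e)^`())%classic s|%:E
       <= K%:E)%E ;
  re_m_zero : forall s : R, 0 <= s <= alpha -> me 0 s = m s ;
  re_m_joint_cont : {within `[0, 1] `*` `[0, alpha],
    continuous (fun p : R * R => me p.1 p.2)} ;
  re_m_smooth : Cinfty_strip alpha me
}.

(** * The scheme *)

(* Cells are numbered from 0: cell i : 'I_N is the source's cell i+1. *)

Definition dx (R : realType) (N : nat) : R := N%:R^-1.

Definition xc (R : realType) (N : nat) (i : 'I_N) : R :=
  (i%:R + 2^-1) * dx R N.

Definition admissible (R : realType) (alpha : R) (N : nat) (rho : 'rV[R]_N)
    : Prop :=
  forall i, 0 <= rho 0 i <= alpha.

Definition l1norm (R : realType) (N : nat) (rho : 'rV[R]_N) : R :=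
  \sum_(i < N) `|rho 0 i|.

Definition xi (R : realType) (alpha : R) (U V : R -> R) (N : nat)
    (rho : 'rV[R]_N) (i : 'I_N) : R :=
  deriv_cc 0 alpha U (rho 0 i) + V (xc R i).

Definition velocity (R : realType) (alpha : R) (U V : R -> R) (N : nat)
    (rho : 'rV[R]_N) (i j : 'I_N) : R :=
  - (xi alpha U V rho j - xi alpha U V rho i) / dx R N.

(* Numerical flux from cell i to its right neighbour j. *)
Definition cell_flux (R : realType) (alpha : R) (m1 m2 U V : R -> R) (N : nat)
    (rho : 'rV[R]_N) (i j : 'I_N) : R :=
  m1 (rho 0 i) * m2 (rho 0 j) * Num.max (velocity alpha U V rho i j) 0 +
  m1 (rho 0 j) * m2 (rho 0 i) * Num.min (velocity alpha U V rho i j) 0.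

(* [face_flux rho k] is F_{k+1/2}, k = 0, ..., N; face k separates cells k-1
   and k (numbered from 0), and the boundary faces 0 and N carry no flux. *)
Definition face_flux (R : realType) (alpha : R) (m1 m2 U V : R -> R) (N : nat)
    (rho : 'rV[R]_N) (k : nat) : R :=
  if k is k'.+1 then
    match insub k' : option 'I_N, insub k'.+1 : option 'I_N with
    | Some i, Some j => cell_flux alpha m1 m2 U V rho i j
    | _, _ => 0
    end
  else 0.

Definition scheme_step (R : realType) (alpha : R) (m1 m2 U V : R -> R)
    (N : nat) (dt : R) (rho0 rho1 : 'rV[R]_N) : Prop :=
  forall i : 'I_N,
    (rho1 0 i - rho0 0 i) / dt =
    - (face_flux alpha m1 m2 U V rho1 i.+1 - face_flux alpha m1 m2 U V rho1 i)
      / dx R N.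

(* The solution of one step in the admissible set; for admissible rho0 and U in
   C^1([0,alpha]) it exists and is unique, so the default 0 is never used. *)
Definition J (R : realType) (alpha : R) (m1 m2 U V : R -> R) (N : nat) (dt : R)
    (rho0 : 'rV[R]_N) : 'rV[R]_N :=
  xget 0 [set rho1 | admissible alpha rho1 /\
                     scheme_step alpha m1 m2 U V dt rho0 rho1].

Definition Jinf (R : realType) (alpha : R) (m1 m2 U V : R -> R) (N : nat)
    (dt : R) (rho0 : 'rV[R]_N) : 'rV[R]_N :=
  lim (iter n (J alpha m1 m2 U V dt) rho0 @[n --> \oo]).

(** * Equilibria *)

Definition deriv_inv (R : realType) (alpha : R) (U : R -> R) : R -> R :=
  'pinv_(fun=> 0) `]0, alpha[ U^`().

(* The inverse of U' : [0,alpha] -> [U'(0),U'(alpha)]. *)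
Definition deriv_inv_cc (R : realType) (alpha : R) (U : R -> R) : R -> R :=
  'pinv_(fun=> 0) `[0, alpha] (deriv_cc 0 alpha U).

(* U'(0^+) and U'(alpha^-) are taken in R: they are finite when U is in
   C^1([0,alpha]). *)
Definition T_inv (R : realType) (alpha : R) (U : R -> R) (z : R) : R :=
  if deriv_cc 0 alpha U alpha <= z then alpha
  else if z <= deriv_cc 0 alpha U 0 then 0
  else deriv_inv alpha U z.

Definition rho_eq (R : realType) (alpha : R) (U V : R -> R) (N : nat) (C : R)
    : 'rV[R]_N :=
  \row_i T_inv alpha U (C - V (xc R i)).

Definition rho_eq_eps (R : realType) (alpha : R) (Ue : R -> R -> R)
    (V : R -> R) (N : nat) (e C : R) : 'rV[R]_N :=
  \row_i deriv_inv alpha (Ue e) (C - V (xc R i)).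

Definition has_mass (R : realType) (N : nat) (M : R) (rho : 'rV[R]_N) : Prop :=
  dx R N * \sum_(i < N) rho 0 i = M.

Definition has_mass_cont (R : realType) (alpha : R) (U V : R -> R) (M C : R)
    : Prop :=
  \int[@lebesgue_measure R]_(x in `]0, 1[) T_inv alpha U (C - V x) = M.

(* Main.v *)
Require Import Defs.
From HB Require Import structures.
From mathcomp Require Import all_boot all_order all_algebra.
From mathcomp Require Import all_classical all_reals all_analysis.
From mathcomp Require Import ring lra.

Set Implicit Arguments.
Unset Strict Implicit.
Unset Printing Implicit Defensive.

Import Order.TTheory GRing.Theory Num.Theory.
Import numFieldNormedType.Exports.

Local Open Scope ring_scope.
Local Open Scope classical_set_scope.

(** The implicit step is a monotone conservation law.  Write the step as
    A(rho1) = rho0 with A(rho)_i = rho_i + (dt/dx) (F_{i+1/2} - F_{i-1/2}).  The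
    upwind flux increases with its left argument and decreases with its right
    one, so A(rho)_i decreases when a cell other than i is raised; the fluxes
    telescope, so A preserves the total; and the two constant states 0 and alpha
    are at rest, because the first mobility vanishes at 0 and the second at alpha.
    These properties alone ([balance_map]) give existence of the step, as the
    subsolution of largest total ([balance_solve]), and the L^1 contraction, by
    comparing two solutions with their join ([balance_contraction]).

    The iterates converge because the energy sum_i U(rho_i) + V(x_i) rho_i is a
    strict Lyapunov function: by convexity and summation by parts a step loses at
    least the power dissipated at the faces, and if that is zero all fluxes vanish
    ([energy_dissipation]).  By LaSalle's principle every cluster point of the
    orbit is a fixed point, and the contraction property upgrades one cluster point
    to a limit ([dissipative_contraction_cvg]).  Contraction passes to the limit.

    For the equilibria it is enough to know the inverses through the Galois
    connection T z < t <-> z < q t, t < T z <-> q t < z on (0,alpha)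
    ([inverse_pair]); it holds for the truncated inverse of U' and for the inverses
    of the U_eps', and it makes T monotone, continuous, and stable under pointwise
    convergence of q.  In the states of (iii) the potential exceeds the level only
    in empty cells and falls short of it only in full cells, so every upwind flux
    vanishes ([rho_eq_stationary]).

    For (iv), U_eps'' = Phi_eps' / m_eps converges to Phi' / m = U'' locally
    uniformly, hence U_eps' converges to U' pointwise ([Ue1_cvg]).  It is onto the
    line since m_eps vanishes linearly at the ends and U_eps'' >= eps / m_eps, which
    forces logarithmic divergence ([deriv_inv_Ue]).  The levels themselves may fail to
    converge, since U' only determines the state of given mass and not its level
    when the cells are all empty or full; but the monotonicity in the level controls
    each cell by the difference of total masses ([level_row_cvg]).

    For (v), the mass F(C) = int_0^1 T(C - V) crosses the value M with at least
    linear speed near C0: by the mean value theorem some point of (0,1) has density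
    exactly M, in the interior of [0,alpha], where U'' is bounded and so T has
    positive slope ([mass_cont_growth]).  This yields uniqueness of C0, and it turns
    the error of the midpoint rule into an error for the level.  That error tends
    to 0 by uniform continuity of T ([level_cvg]); it is O(dx) when inf U'' > 0,
    because T is then Lipschitz ([level_rate]). *)

(** * Truncation to an interval, and finite sums of limits *)

Definition clamp (R : realType) (a b x : R) : R := Num.max a (Num.min x b).

Lemma clamp_itv (R : realType) (a b x : R) :
  a <= b -> a <= clamp a b x <= b.
Proof.
by move=> ab; rewrite /clamp le_max lexx/= ge_max ab ge_min lexx orbT.
Qed.

Lemma clamp_id (R : realType) (a b x : R) : a <= x <= b -> clamp a b x = x.
Proof. by move=> /andP[ax xb]; rewrite /clamp (min_idPl xb) (max_idPr ax). Qed.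

Lemma continuous_clamp (R : realType) (a b : R) : continuous (clamp a b).
Proof.
move=> x; apply: (@continuous_max _ _ (fun=> a) (fun y => Num.min y b)).
  exact: cvg_cst.
by apply: (@continuous_min _ _ id (fun=> b)) => //; exact: cvg_cst.
Qed.

(** Composing with the truncation turns continuity on the segment into
    continuity on the line, where the usual calculus of limits applies. *)
Lemma continuous_comp_clamp (R : realType) (a b : R) (f : R -> R) :
  a <= b -> {within `[a, b], continuous f} -> continuous (f \o clamp a b).
Proof.
move=> ab cf x.
have cab : `[a, b]%classic (clamp a b x) by rewrite /= in_itv/= clamp_itv.
have /subspace_continuousP := cf.
move=> /(_ (clamp a b x) cab) h.
apply: (@cvg_comp _ _ _ (clamp a b) f (nbhs x)
  (within `[a, b] (nbhs (clamp a b x)))); last exact: h.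
move=> P; rewrite /within/= => hP.
have nP : \forall y \near x, `[a, b]%classic (clamp a b y) -> P (clamp a b y).
  exact: continuous_clamp hP.
suff : \forall y \near x, P (clamp a b y) by [].
by apply: filterS nP => y; apply; rewrite /= in_itv/=; exact: clamp_itv.
Qed.

Lemma cvg_finite_sum (R : realType) (I : finType) (T : Type) (F : set_system T)
    {FF : Filter F} (f : I -> T -> R) (l : I -> R) :
  (forall i, f i x @[x --> F] --> l i) ->
  (\sum_i f i x) @[x --> F] --> \sum_i l i.
Proof. by move=> fl; apply: cvg_big => //; exact: add_continuous. Qed.

Section rows.
Context {R : realType} {N : nat}.
Implicit Types (u v w : 'rV[R]_N).

(** Row vectors carry the topology of entrywise convergence. *)
Lemma cvg_row (T : Type) (F : set_system T) {FF : Filter F}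
    (f : T -> 'rV[R]_N) v :
  (forall i, f x 0 i @[x --> F] --> v 0 i) -> f x @[x --> F] --> v.
Proof.
move=> fv; apply/cvg_ballP => e e0.
have : \forall x \near F, forall i, ball (v 0 i) e (f x 0 i).
  apply: filter_forall => i; have := fv i.
  by move=> /cvg_ballP; apply.
by apply: filterS => x h; split=> // i j; rewrite ord1.
Qed.

Lemma row_cvg (T : Type) (F : set_system T) {FF : Filter F}
    (f : T -> 'rV[R]_N) v i :
  f x @[x --> F] --> v -> f x 0 i @[x --> F] --> v 0 i.
Proof.
move=> fv; apply: (@cvg_comp _ _ _ f (fun u : 'rV_N => u 0 i) F _ _ fv).
exact: (@coord_continuous R 1 N 0 i v).
Qed.

Lemma coord_le_l1norm u i : `|u 0 i| <= l1norm u.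
Proof.
by rewrite /l1norm (bigD1 i)//= lerDl; apply: sumr_ge0.
Qed.

Lemma l1norm_eq0 u : l1norm u <= 0 -> u = 0.
Proof.
move=> u0; apply/rowP => i; rewrite mxE; apply/eqP.
by rewrite -normr_le0 (le_trans (coord_le_l1norm u i)).
Qed.

Lemma cvg_l1norm (T : Type) (F : set_system T) {FF : Filter F}
    (f : T -> 'rV[R]_N) v :
  f x @[x --> F] --> v -> l1norm (f x) @[x --> F] --> l1norm v.
Proof.
move=> fv; apply: cvg_finite_sum => i; apply: cvg_norm; exact: row_cvg.
Qed.

Lemma nbhs_l1norm v (P : set 'rV[R]_N) :
  nbhs v P -> exists2 e : R, 0 < e & forall w, l1norm (v - w) < e -> P w.
Proof.
move=> /nbhs_ballP[e e0 eP]; exists e => // w vw; apply: eP; split => // i j.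
rewrite ord1 /ball/= /ball_/= (le_lt_trans _ vw)//.
by have := coord_le_l1norm (v - w) j; rewrite !mxE.
Qed.

Definition clampv (alpha : R) u : 'rV[R]_N := \row_i clamp 0 alpha (u 0 i).

Lemma clampv_id alpha u : admissible alpha u -> clampv alpha u = u.
Proof. by move=> au; apply/rowP => i; rewrite mxE clamp_id. Qed.

Lemma compact_admissible alpha : compact [set u | @admissible R alpha N u].
Proof.
have := @rV_compact R N (fun=> `[0, alpha]%classic)
  (fun=> @segment_compact _ _ _).
suff -> : [set u : 'rV[R]_N | admissible alpha u] =
  [set u | forall i, `[0, alpha]%classic (u ord0 i)] by [].
by apply/seteqP; split => u h i; have := h i; rewrite /= in_itv.
Qed.

End rows.

(** * Balance maps: order-preserving discrete conservation laws *)

(** The map inverted by one implicit step of a monotone conservative scheme: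
    raising the neighbours of a cell lowers the balance of that cell, the total
    is preserved, and the two constant extreme states are at rest. *)
Record balance_map (R : realType) (alpha : R) (N : nat)
    (A : 'rV[R]_N -> 'rV[R]_N) : Prop := BalanceMap {
  bm_offdiag : forall (u v : 'rV[R]_N) (i : 'I_N),
    admissible alpha u -> admissible alpha v ->
    (forall j, u 0 j <= v 0 j) -> u 0 i = v 0 i -> A v 0 i <= A u 0 i ;
  bm_sum : forall u, admissible alpha u -> \sum_i A u 0 i = \sum_i u 0 i ;
  bm_0 : forall i, A 0 0 i = 0 ;
  bm_alpha : forall i, A (const_mx alpha) 0 i = alpha ;
  bm_cont : forall i, continuous (fun u => A (clampv alpha u) 0 i)
}.

Section balance.
Context {R : realType} {alpha : R} {N : nat} {A : 'rV[R]_N -> 'rV[R]_N}.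
Hypotheses (alpha_ge0 : 0 <= alpha) (bA : balance_map alpha A).
Implicit Types (u v r s : 'rV[R]_N).

(** Perron's method: among the subsolutions take one of largest total.  A strict
    inequality in some cell could be used to raise that cell, which only lowers
    the balance of the other cells. *)
Lemma balance_solve r : admissible alpha r ->
  exists2 u, admissible alpha u & A u = r.
Proof.
move=> ar.
pose S := [set u | admissible alpha u] `&`
          [set u | forall i, A (clampv alpha u) 0 i <= r 0 i].
have S_compact : compact S.
  apply: compact_closedI; first exact: compact_admissible.
  have -> : [set u | forall i, A (clampv alpha u) 0 i <= r 0 i] =
      \bigcap_(i in [set: 'I_N])
        (fun u => A (clampv alpha u) 0 i) @^-1` [set y | y <= r 0 i].
    by apply/seteqP; split => [u h i _|u h i] /=; [exact: h|exact: (h i)].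
  apply: closed_bigI => i _; apply: preimage_closed; last exact: closed_le.
  by move=> u _; exact: (bm_cont bA).
have S0 : S !=set0.
  exists 0; split => i /=; first by rewrite mxE lexx alpha_ge0.
  rewrite clampv_id; last by move=> j; rewrite mxE lexx alpha_ge0.
  by rewrite (bm_0 bA); case/andP: (ar i).
have total_cont : continuous (fun u : 'rV[R]_N => \sum_i u 0 i).
  by move=> u; apply: (cvg_finite_sum (F := nbhs u)) => i; exact: coord_continuous.
have [u /set_mem[/= au Aur] umax] :=
  EVT_max_rV S0 S_compact (continuous_subspaceT total_cont).
exists u => //; apply/rowP => i; apply/eqP; rewrite eq_le.
have := Aur; rewrite clampv_id// => Aur'.
rewrite (Aur' i) leNgt; apply/negP => Ai.
have [ui|ui] := leP alpha (u 0 i).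
  have ui' : u 0 i = alpha by apply/eqP; rewrite eq_le ui andbT; case/andP: (au i).
  have: A (const_mx alpha) 0 i <= A u 0 i.
    apply: (bm_offdiag bA) => //; rewrite ?mxE//.
    - by move=> j; rewrite mxE lexx alpha_ge0.
    - by move=> j; rewrite mxE; case/andP: (au j).
  rewrite (bm_alpha bA) => h; have := lt_le_trans Ai (proj2 (andP (ar i))).
  by rewrite ltNge h.
pose w (t : R) : 'rV[R]_N := \row_j (if j == i then u 0 i + t else u 0 j).
have w0 : w 0 = u.
  by apply/rowP => j; rewrite mxE addr0; case: eqP => // ->.
have w_cont : w t @[t --> 0^'+] --> u.
  apply: cvg_row => j; under eq_fun do rewrite mxE.
  case: eqP => [->|_]; last exact: cvg_cst.
  have : u 0 i + t @[t --> 0^'+] --> u 0 i + 0.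
    by apply: cvgD; [exact: cvg_cst|exact: cvg_at_right_filter].
  by rewrite addr0.
have : \forall t \near 0^'+, [/\ 0 < t, u 0 i + t < alpha &
    A (clampv alpha (w t)) 0 i < r 0 i].
  near=> t; split.
  - by near: t; exact: nbhs_right_gt.
  - have : t < alpha - u 0 i by near: t; apply: nbhs_right_lt; rewrite subr_gt0.
    by rewrite ltrBrDl.
  - near: t.
    have Ac : A (clampv alpha (w t)) 0 i @[t --> 0^'+] -->
        A (clampv alpha u) 0 i.
      have Au := bm_cont bA (i := i) (x := u).
      exact: (@cvg_comp _ _ _ w (fun u => A (clampv alpha u) 0 i)
        0^'+ (nbhs u) _ w_cont Au).
    by apply: (cvgr_lt _ Ac); rewrite clampv_id.
move=> /filter_ex[t [t0 ta At]].
have aw : admissible alpha (w t).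
  move=> j; rewrite mxE; case: eqP => _; last exact: au.
  by rewrite (ltW ta) andbT addr_ge0 ?(ltW t0)//; case/andP: (au i).
have : S (w t).
  split=> // j /=; have [->|ji] := eqVneq j i; first exact: ltW.
  rewrite clampv_id//; apply: le_trans (Aur' j).
  apply: (bm_offdiag bA) => //; last by rewrite mxE (negbTE ji).
  by move=> k; rewrite mxE; case: eqP => // ->; rewrite lerDl ltW.
move=> /mem_set /umax; apply/negP; rewrite -ltNge.
rewrite (bigD1 i)//= [ltRHS](bigD1 i)//= mxE eqxx.
have -> : \sum_(j < N | j != i) w t 0 j = \sum_(j < N | j != i) u 0 j.
  by apply: eq_bigr => j /negbTE ji; rewrite mxE ji.
by rewrite ltrD2r ltrDl.
Unshelve. all: by end_near. Qed.

(** Crandall and Tartar's argument: the balance of the join of two states is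
    at most the join of their balances, and totals are preserved. *)
Lemma balance_contraction u v : admissible alpha u -> admissible alpha v ->
  l1norm (u - v) <= l1norm (A u - A v).
Proof.
move=> au av; pose w : 'rV[R]_N := \row_i Num.max (u 0 i) (v 0 i).
have aw : admissible alpha w.
  move=> i; rewrite mxE; have [/andP[u0 u1] /andP[v0 v1]] := (au i, av i).
  by rewrite le_max u0/= ge_max u1.
have wmax i : A w 0 i <= Num.max (A u 0 i) (A v 0 i).
  rewrite le_max; have [uv|vu] := leP (u 0 i) (v 0 i); apply/orP.
    right; apply: (bm_offdiag bA) => //; last by rewrite mxE (max_idPr uv).
    by move=> j; rewrite mxE le_max lexx orbT.
  left; apply: (bm_offdiag bA) => //; last by rewrite mxE (max_idPl (ltW vu)).
  by move=> j; rewrite mxE le_max lexx.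
have dist (a b : R) : `|a - b| = 2 * Num.max a b - (a + b).
  by rewrite maxr_absE; field.
have l1 (a b : 'rV[R]_N) : l1norm (a - b) =
    2 * \sum_i Num.max (a 0 i) (b 0 i) - (\sum_i a 0 i + \sum_i b 0 i).
  rewrite /l1norm -big_split/= mulr_sumr -sumrB; apply: eq_bigr => i _.
  by rewrite !mxE dist.
rewrite !l1 !(bm_sum bA)// lerD2r ler_pM2l//.
have -> : \sum_i Num.max (u 0 i) (v 0 i) = \sum_i w 0 i.
  by apply: eq_bigr => i _; rewrite mxE.
by rewrite -(bm_sum bA)//; apply: ler_sum.
Qed.

Lemma balance_inj u v : admissible alpha u -> admissible alpha v ->
  A u = A v -> u = v.
Proof.
move=> au av Auv; apply/subr0_eq/l1norm_eq0.
rewrite (le_trans (balance_contraction au av))// Auv subrr.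
by rewrite /l1norm big1// => i _; rewrite mxE normr0.
Qed.

End balance.

(** * Convergence of the iterates of a dissipative contraction *)

Section lasalle.
Context {R : realType} {alpha : R} {N : nat}.
Variables (J : 'rV[R]_N -> 'rV[R]_N) (E : 'rV[R]_N -> R).
Hypothesis J_adm : forall u, admissible alpha u -> admissible alpha (J u).
Hypothesis J_contr : forall u v, admissible alpha u -> admissible alpha v ->
  l1norm (J u - J v) <= l1norm (u - v).
Hypothesis E_cont : continuous E.
Hypothesis E_decr : forall u, admissible alpha u -> E (J u) <= E u.
Hypothesis E_strict : forall u, admissible alpha u -> E u <= E (J u) -> J u = u.

Lemma iter_adm n u : admissible alpha u -> admissible alpha (iter n J u).
Proof. by move=> au; elim: n => //= n; exact: J_adm. Qed.

Lemma iter_contraction n u v : admissible alpha u -> admissible alpha v ->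
  l1norm (iter n J u - iter n J v) <= l1norm (u - v).
Proof.
move=> au av; elim: n => //= n IH.
by apply: le_trans IH; apply: J_contr; exact: iter_adm.
Qed.

(** LaSalle's invariance principle.  Along the orbit of u the energy stays
    above its value at any cluster point c; if it dropped strictly from c to J c,
    it would also drop below E c one step after the orbit comes close to c.  Hence
    c is a fixed point, and the contraction property makes the orbit, once
    close to c, stay close to c. *)
Lemma dissipative_contraction_cvg u : admissible alpha u ->
  exists c, [/\ admissible alpha c, J c = c & iter n J u @[n --> \oo] --> c].
Proof.
move=> au; pose x n := iter n J u.
have ax n : admissible alpha (x n) by exact: iter_adm.
have [] := @compact_admissible R N alpha (x @ \oo) _.
  by exists 0%N => // n _ /=; exact: ax.
move=> c [/= ac clc].
have often (P : set 'rV[R]_N) n : nbhs c P -> exists2 k, (n <= k)%N & P (x k).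
  move=> Pc.
  have xn : (x @ \oo) (x @` [set k | (n <= k)%N]).
    by exists n => // k nk; exists k.
  by have [_ [[k nk <-] Pk]] := clc _ _ xn Pc; exists k.
have E_noninc n k : (n <= k)%N -> E (x k) <= E (x n).
  move=> /subnK <-; elim: (k - n)%N => // j; apply: le_trans.
  by rewrite addSn /x/=; apply: E_decr; exact: ax.
have E_above n : E c <= E (x n).
  rewrite leNgt; apply/negP => En.
  have [k nk] := often [set v | E (x n) < E v] n (cvgr_gt _ (E_cont (x := c)) _ En).
  by rewrite /= ltNge E_noninc.
have nbhs_l1 e : 0 < e -> nbhs c [set v | l1norm (c - v) < e].
  move=> e0.
  have : l1norm (c - v) @[v --> c] --> (0 : R).
    have -> : 0 = l1norm (c - c).
      by rewrite subrr /l1norm big1// => i _; rewrite mxE normr0.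
    apply: (@cvg_l1norm _ _ _ (nbhs c) _ (fun v => c - v)).
    by apply: cvgB; [exact: cvg_cst|exact: cvg_id].
  by move=> h; exact: (cvgr_lt _ h _ e0).
have Jc : J c = c.
  apply: E_strict => //; rewrite leNgt; apply/negP => EJc.
  have [e e0 eP] := nbhs_l1norm (cvgr_lt _ (E_cont (x := J c)) _ EJc).
  have [k _ /= ck] := often _ 0%N (nbhs_l1 _ e0).
  have := eP (J (x k)) (le_lt_trans (J_contr ac (ax k)) ck).
  by rewrite ltNge -[J (x k)]/(x k.+1) E_above.
exists c; split => //.
move=> P /nbhs_l1norm[e e0 eP].
have [k _ /= ck] := often _ 0%N (nbhs_l1 _ e0).
exists k => // n /= kn; apply: eP; apply: le_lt_trans ck.
have Jcn j : iter j J c = c by elim: j => //= j ->.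
rewrite -(subnK kn) /x iterD -[c in c - iter _ _ _](Jcn (n - k)%N).
exact: iter_contraction (ac) (ax k).
Qed.

End lasalle.

(** * Functions of class C^1 on a segment *)

Lemma Ck_oo_is_derive (R : realType) (k j : nat) (a b : R) (f : R -> R) x :
  Ck_oo k a b f -> (j < k)%N -> a < x < b ->
  is_derive x 1 (f^`(j)) ((f^`(j.+1)) x).
Proof.
move=> fk jk xab; have [/(_ j jk) fd _] := fk x xab.
by rewrite derive1nS derive1E; exact: derivableP.
Qed.

Lemma Ck_oo_continuous (R : realType) (k j : nat) (a b : R) (f : R -> R) x :
  Ck_oo k a b f -> (j < k)%N -> a < x < b -> {for x, continuous (f^`(j))%classic}.
Proof.
move=> fk jk xab; have d := Ck_oo_is_derive fk jk xab.
by apply: differentiable_continuous; apply/derivable1_diffP; case: d.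
Qed.

Lemma Ck_oo_MVT (R : realType) (k : nat) (a b s t : R) (f : R -> R) :
  Ck_oo k a b f -> (1 < k)%N -> a < s -> s < t -> t < b ->
  exists2 c, s < c < t &
    (f^`())%classic t - (f^`())%classic s = (f^`(2))%classic c * (t - s).
Proof.
move=> fk k1 as_ st tb.
have in_ab x : s <= x <= t -> a < x < b.
  by move=> /andP[sx xt]; rewrite (lt_le_trans as_ sx) (le_lt_trans xt tb).
have [||c cst E] := @MVT R (f^`(1))%classic (f^`(2))%classic s t st.
- move=> x; rewrite in_itv/= => /andP[/ltW sx /ltW xt].
  by apply: (Ck_oo_is_derive fk k1); rewrite in_ab ?sx.
- apply: continuous_in_subspaceT => x; rewrite inE/= in_itv/= => xst.
  exact: (Ck_oo_continuous fk k1 (in_ab _ xst)).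
by exists c; [move: cst; rewrite in_itv|rewrite -derive1n1].
Qed.

Section deriv_cc.
Context {R : realType} {a b : R}.
Hypothesis ab : a < b.
Implicit Type f : R -> R.

Lemma deriv_cc_in f s : a < s < b -> deriv_cc a b f s = f^`() s.
Proof. by move=> /andP[sa sb]; rewrite /deriv_cc leNgt sa/= leNgt sb. Qed.

(** The one-sided limits at the ends are the values there of the continuous
    extension of the derivative. *)
Lemma deriv_ccE k f : (0 < k)%N -> Ck_cc k a b f ->
  exists2 g : R -> R, {within `[a, b], continuous g} &
    deriv_cc a b f = g \o clamp a b.
Proof.
move=> k0 [_ _ /(_ 1%N k0)[g cg gf]]; exists g => //.
have [_ ga gb] := (continuous_within_itvP g ab).1 cg.
have gf' x : a < x < b -> g x = f^`() x by move=> /gf ->; rewrite derive1n1.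
apply/funext => s /=; rewrite /deriv_cc; case: leP => sa.
  have -> : clamp a b s = a.
    by rewrite /clamp (min_idPl (le_trans sa (ltW ab))) (max_idPl sa).
  apply: cvg_lim => //; apply: cvg_trans ga; apply: near_eq_cvg.
  near=> x; rewrite -gf'//; apply/andP; split; near: x.
    exact: nbhs_right_gt.
  exact: nbhs_right_lt.
case: leP => sb.
  have -> : clamp a b s = b.
    by rewrite /clamp (min_idPr sb) (max_idPr (ltW ab)).
  apply: cvg_lim => //; apply: cvg_trans gb; apply: near_eq_cvg.
  near=> x; rewrite -gf'//; apply/andP; split; near: x.
    exact: nbhs_left_gt.
  exact: nbhs_left_lt.
by rewrite clamp_id ?(ltW sa) ?(ltW sb)// gf'// sa.
Unshelve. all: by end_near. Qed.

Lemma continuous_deriv_cc k f : (0 < k)%N -> Ck_cc k a b f ->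
  continuous (deriv_cc a b f).
Proof.
move=> k0 fk; have [g cg ->] := deriv_ccE k0 fk.
exact/continuous_comp_clamp/cg/ltW.
Qed.

Lemma Ck_cc_MVT k f s t : (0 < k)%N -> Ck_cc k a b f ->
  a <= s -> s <= t -> t <= b ->
  exists2 c, s <= c <= t & f t - f s = deriv_cc a b f c * (t - s).
Proof.
move=> k0 [fk cf _] as_ st tb; have := st; rewrite le_eqVlt => /predU1P[->|st'].
  by exists t; rewrite ?lexx// !subrr mulr0.
have [||c cst ->] := @MVT R f (deriv_cc a b f) s t st'.
- move=> x /=; rewrite in_itv/= => /andP[sx xt].
  have xab : a < x < b by rewrite (le_lt_trans as_ sx) (lt_le_trans xt tb).
  have := Ck_oo_is_derive fk k0 xab.
  by rewrite deriv_cc_in// derive1n1.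
- apply: continuous_subspaceW cf => x /=; rewrite !in_itv/= => /andP[sx xt].
  by rewrite (le_trans as_ sx) (le_trans xt tb).
exists c => //; move: cst; rewrite in_itv/= => /andP[/ltW -> /ltW ->//].
Qed.

Lemma Ck_cc_lipschitz k f : (0 < k)%N -> Ck_cc k a b f ->
  exists2 L : R, 0 < L &
    forall s t, a <= s <= b -> a <= t <= b -> `|f t - f s| <= L * `|t - s|.
Proof.
move=> k0 fk; have cd := continuous_deriv_cc k0 fk.
have cn : {within `[a, b], continuous (fun x => `|deriv_cc a b f x|)}.
  by apply: continuous_subspaceT => x; apply: cvg_norm; exact: cd.
have [c cab cmax] := EVT_max (ltW ab) cn.
exists (`|deriv_cc a b f c| + 1) => [|s t]; first by rewrite ltr_wpDl.
wlog st : s t / s <= t.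
  move=> wl sab tab; have [st|/ltW ts] := leP s t; first exact: wl.
  by rewrite distrC [in leRHS]distrC; exact: wl.
move=> /andP[as_ sb] /andP[at_ tb].
have [d /andP[sd dt] ->] := Ck_cc_MVT k0 fk as_ st tb.
rewrite normrM ler_wpM2r// ler_wpDr// cmax// in_itv/=.
by rewrite (le_trans as_ sd) (le_trans dt tb).
Qed.

End deriv_cc.

(** * A convex function of class C^1 and its derivative *)

Section convex_C1.
Context {R : realType} {alpha : R} {U : R -> R}.
Hypotheses (alpha_gt0 : 0 < alpha) (U1 : Ck_cc 1 0 alpha U)
  (U3 : Ck_oo 3 0 alpha U).
Hypothesis U_convex : forall s, 0 < s < alpha -> 0 <= (U^`(2)) s.
Let p := deriv_cc 0 alpha U.

Let p_cont : continuous p.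
Proof. exact: continuous_deriv_cc U1. Qed.

Lemma is_derive_deriv_cc s : 0 < s < alpha -> is_derive s 1 p ((U^`(2)) s).
Proof.
move=> sa; have U2 := Ck_oo_is_derive (j := 1%N) U3 isT sa.
apply: near_eq_is_derive U2; near=> x.
rewrite derive1n1 /p deriv_cc_in//; apply/andP; split; near: x.
  by apply: lt_nbhsr; case/andP: sa.
by apply: lt_nbhsl; case/andP: sa.
Unshelve. all: by end_near. Qed.

Lemma deriv_cc_MVT s t : 0 <= s -> s < t -> t <= alpha ->
  exists2 c, s < c < t & p t - p s = (U^`(2))%classic c * (t - s).
Proof.
move=> s0 st ta.
have [||c cst ->] := @MVT R p (U^`(2))%classic s t st.
- move=> x; rewrite in_itv/= => /andP[sx xt]; apply: is_derive_deriv_cc.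
  by rewrite (le_lt_trans s0 sx) (lt_le_trans xt ta).
- exact: continuous_subspaceT.
by exists c => //; move: cst; rewrite in_itv.
Qed.

Lemma deriv_cc_homo s t : 0 <= s -> s <= t -> t <= alpha -> p s <= p t.
Proof.
move=> s0 st ta; have := st; rewrite le_eqVlt => /predU1P[->//|st'].
have [c /andP[sc ct] E] := deriv_cc_MVT s0 st' ta.
rewrite -subr_ge0 E mulr_ge0 ?subr_ge0// U_convex//.
by rewrite (le_lt_trans s0 sc) (lt_le_trans ct ta).
Qed.

Lemma convex_tangent s t : 0 <= s <= alpha -> 0 <= t <= alpha ->
  U t - U s <= p t * (t - s).
Proof.
move=> /andP[s0 sa] /andP[t0 ta]; have [st|/ltW ts] := leP s t.
  have [c /andP[sc ct] ->] := Ck_cc_MVT (ltn0Sn 0) U1 s0 st ta.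
  by rewrite ler_wpM2r ?subr_ge0// deriv_cc_homo// (le_trans s0 sc).
have [c /andP[tc cs] E] := Ck_cc_MVT (ltn0Sn 0) U1 t0 ts sa.
rewrite -lerN2 -mulrN !opprB E ler_wpM2r ?subr_ge0// deriv_cc_homo//.
exact: le_trans cs sa.
Qed.

(** On an interval where the monotone function U' is constant its derivative
    vanishes, and an interval is not negligible. *)
Lemma deriv_cc_strict :
  {ae @lebesgue_measure R, forall s : R, 0 < s < alpha -> 0 < (U^`(2)) s} ->
  forall s t, 0 <= s -> s < t -> t <= alpha -> p s < p t.
Proof.
move=> U2_pos s t s0 st ta; rewrite lt_neqAle (deriv_cc_homo s0 (ltW st) ta).
rewrite andbT; apply/eqP => pst.
have U2_0 x : s < x < t -> (U^`(2)) x = 0.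
  move=> /andP[sx xt].
  have xa : 0 < x < alpha by rewrite (le_lt_trans s0 sx) (lt_le_trans xt ta).
  have pc y : s < y < t -> p y = p s.
    move=> /andP[sy yt]; apply/eqP; rewrite eq_le {1}pst.
    rewrite (deriv_cc_homo _ (ltW yt) ta) ?(le_trans s0 (ltW sy))//=.
    by rewrite deriv_cc_homo// ?(ltW sy)// (le_trans (ltW yt) ta).
  have d0 : is_derive x 1 p (0 : R).
    apply: (@near_eq_is_derive _ _ _ (cst (p s))).
    near=> y; rewrite pc//; apply/andP; split; near: y.
      exact: lt_nbhsr.
    exact: lt_nbhsl.
  have dp := is_derive_deriv_cc xa.
  by rewrite -(@derive_val _ _ _ _ _ _ _ dp) (@derive_val _ _ _ _ _ _ _ d0).
have [B [mB B0 subB]] := U2_pos.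
have : (@lebesgue_measure R (`]s, t[) <= lebesgue_measure B)%E.
  apply: le_measure; rewrite ?inE//= => x /=; rewrite in_itv/= => xst.
  apply: subB => h; have xa : 0 < x < alpha.
    move: xst => /andP[sx xt]; by rewrite (le_lt_trans s0 sx) (lt_le_trans xt ta).
  by have := h xa; rewrite U2_0// ltxx.
by rewrite B0 lebesgue_measure_itv/= lte_fin st -EFinD lee_fin leNgt subr_gt0 st.
Unshelve. all: by end_near. Qed.

End convex_C1.

(** * The upwind flux *)

Lemma lipschitz_continuous_clamp (R : realType) (a b : R) (f : R -> R) :
  a <= b -> [lipschitz f s | s in `[a, b]] -> continuous (f \o clamp a b).
Proof.
move=> ab [K [_ lipf]]; have {}lipf := lipf (`|K| + 1) (ltr_pwDr ltr01 (ler_norm _)).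
move=> x; apply/cvgrPdist_lt => e e0.
have c_gt0 : 0 < `|K| + 1 by rewrite ltr_wpDl.
have := (@cvgrPdist_lt _ _ _ _ _ _ _).1 (continuous_clamp (a := a) (b := b) (x := x)).
move=> /(_ _ (e / (`|K| + 1))); rewrite divr_gt0// => /(_ isT).
apply: filterS => y; rewrite ltr_pdivlMr// mulrC; apply: le_lt_trans.
by apply: (lipf (clamp a b x, clamp a b y)); split; rewrite /= in_itv/= clamp_itv.
Qed.

Section upwind.
Context {R : realDomainType}.
Implicit Types c d v w : R.

Lemma upwind_le c1 c2 d1 d2 v w : 0 <= c1 <= d1 -> 0 <= d2 <= c2 -> v <= w ->
  c1 * Num.max v 0 + c2 * Num.min v 0 <= d1 * Num.max w 0 + d2 * Num.min w 0.
Proof.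
move=> /andP[c1_ge0 cd1] /andP[d2_ge0 dc2] vw; apply: lerD.
  apply: ler_pM => //; first by rewrite le_max lexx orbT.
  by rewrite ge_max !le_max vw lexx orbT.
rewrite -lerN2 -!mulrN; apply: ler_pM => //.
  by rewrite oppr_ge0 ge_min lexx orbT.
by rewrite lerN2 le_min !ge_min vw lexx orbT.
Qed.

(** Only the term selected by the sign of v survives, so the power F v is a
    nonnegative multiple of v^2. *)
Lemma upwind_power c1 c2 v : 0 <= c1 -> 0 <= c2 ->
  let F := c1 * Num.max v 0 + c2 * Num.min v 0 in
  0 <= F * v /\ (F * v = 0 -> F = 0).
Proof.
move=> c1_ge0 c2_ge0 F; rewrite {}/F.
have [v_ge0|/ltW v_le0] := leP 0 v.
  rewrite mulr0 addr0 -mulrA mulr_ge0 ?mulr_ge0//; split=> // /eqP.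
  by rewrite mulf_eq0 mulf_eq0 orbb => h; apply/eqP; rewrite mulf_eq0.
rewrite mulr0 add0r -mulrA mulr_ge0 ?mulr_le0//; split=> // /eqP.
by rewrite mulf_eq0 mulf_eq0 orbb => h; apply/eqP; rewrite mulf_eq0.
Qed.

End upwind.

Section scheme.
Context {R : realType} {alpha : R} {m m1 m2 U V : R -> R} {N : nat} {dt : R}.
Hypotheses (alpha_gt0 : 0 < alpha) (m_0 : m 0 = 0) (m_alpha : m alpha = 0).
Hypothesis m_pos : forall s, 0 < s < alpha -> 0 < m s.
Hypothesis Hmd : mobility_decomposition alpha m m1 m2.
Hypotheses (U1 : Ck_cc 1 0 alpha U) (U3 : Ck_oo 3 0 alpha U).
Hypothesis U_convex : forall s, 0 < s < alpha -> 0 <= (U^`(2)) s.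
Hypotheses (N_gt0 : (0 < N)%N) (dt_gt0 : 0 < dt).
Implicit Types (u v rho eta : 'rV[R]_N) (i j : 'I_N).

Local Notation cell_flux := (@cell_flux R alpha m1 m2 U V N).
Local Notation face_flux := (@face_flux R alpha m1 m2 U V N).
Local Notation velocity := (@velocity R alpha U V N).
Local Notation xi := (@xi R alpha U V N).
Local Notation J := (@J R alpha m1 m2 U V N dt).
Let p := deriv_cc 0 alpha U.

Let dx_gt0 : 0 < dx R N.
Proof. by rewrite invr_gt0 ltr0n. Qed.

Let half_itv : 0 < alpha / 2 < alpha.
Proof. by have a0 := alpha_gt0; apply/andP; split; lra. Qed.

Let m1_ge0 := md_m1_ge0 Hmd.
Let m2_ge0 := md_m2_ge0 Hmd.

(** The total mobility vanishes at both ends but not in between, so each factor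
    vanishes at its own end. *)
Lemma mobility1_0 : m1 0 = 0.
Proof.
have /andP[h0 ha] := half_itv.
have hh : 0 <= alpha / 2 <= alpha by rewrite !ltW.
have := md_prod Hmd (s := 0); rewrite lexx (ltW alpha_gt0) => /(_ isT)/esym/eqP.
rewrite m_0 mulf_eq0 => /orP[/eqP//|/eqP m20].
have := m_pos half_itv; rewrite (md_prod Hmd hh).
suff -> : m2 (alpha / 2) = 0 by rewrite mulr0 ltxx.
by apply/eqP; rewrite eq_le m2_ge0// -m20 (md_m2_nonincr Hmd)// ltW.
Qed.

Lemma mobility2_alpha : m2 alpha = 0.
Proof.
have /andP[h0 ha] := half_itv.
have hh : 0 <= alpha / 2 <= alpha by rewrite !ltW.
have := md_prod Hmd (s := alpha).
rewrite lexx (ltW alpha_gt0) => /(_ isT)/esym/eqP.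
rewrite m_alpha mulf_eq0 => /orP[/eqP m1a|/eqP//].
have := m_pos half_itv; rewrite (md_prod Hmd hh).
suff -> : m1 (alpha / 2) = 0 by rewrite mul0r ltxx.
by apply/eqP; rewrite eq_le m1_ge0// -m1a (md_m1_nondecr Hmd)// ltW.
Qed.

Lemma velocity_le u v i j : admissible alpha u -> admissible alpha v ->
  u 0 i <= v 0 i -> v 0 j <= u 0 j -> velocity u i j <= velocity v i j.
Proof.
move=> au av uvi vuj.
rewrite /Defs.velocity /Defs.xi ler_pM2r ?invr_gt0 ?ltr0n// !opprB.
have [/andP[u0 _] /andP[_ va]] := (au i, av i).
have [/andP[v0 _] /andP[_ ua]] := (av j, au j).
have := deriv_cc_homo alpha_gt0 U1 U3 U_convex u0 uvi va.
have := deriv_cc_homo alpha_gt0 U1 U3 U_convex v0 vuj ua.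
move=> /= h1 h2; lra.
Qed.

(** Raising the left state or lowering the right one raises the velocity and the
    mobility for flow to the right, and lowers the mobility for flow to the left. *)
Lemma cell_flux_le u v i j : admissible alpha u -> admissible alpha v ->
  u 0 i <= v 0 i -> v 0 j <= u 0 j -> cell_flux u i j <= cell_flux v i j.
Proof.
move=> au av uvi vuj; apply: upwind_le; last exact: velocity_le.
  rewrite mulr_ge0 ?m1_ge0 ?m2_ge0//=.
  have [/andP[u0 _] /andP[_ va]] := (au i, av i).
  have [/andP[v0 _] /andP[_ ua]] := (av j, au j).
  apply: ler_pM; rewrite ?m1_ge0 ?m2_ge0//; first exact: (md_m1_nondecr Hmd).
  exact: (md_m2_nonincr Hmd).
rewrite mulr_ge0 ?m1_ge0 ?m2_ge0//=.
have [/andP[u0 _] /andP[_ va]] := (au i, av i).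
have [/andP[v0 _] /andP[_ ua]] := (av j, au j).
apply: ler_pM; rewrite ?m1_ge0 ?m2_ge0//; first exact: (md_m1_nondecr Hmd).
exact: (md_m2_nonincr Hmd).
Qed.

Lemma face_fluxP k : (forall rho, face_flux rho k = 0) \/
  exists i j, [/\ k = i.+1, j = i.+1 :> nat &
    forall rho, face_flux rho k = cell_flux rho i j].
Proof.
case: k => [|k]; first by left.
rewrite /Defs.face_flux; case: insubP => [i ki ei|_]; last by left.
case: insubP => [j kj ej|_]; last by left.
by right; exists i, j; split => //; rewrite ?ei// ej.
Qed.

Lemma face_flux_last rho : face_flux rho N = 0.
Proof.
have [//|[i [j [Ni ji _]]]] := face_fluxP N.
by have := ltn_ord j; rewrite ji -Ni ltnn.
Qed.

Definition balance rho : 'rV[R]_N :=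
  \row_i (rho 0 i + dt / dx R N * (face_flux rho i.+1 - face_flux rho i)).

Lemma scheme_stepE rho0 rho1 :
  scheme_step alpha m1 m2 U V dt rho0 rho1 <-> balance rho1 = rho0.
Proof.
have dxn0 : dx R N != 0 by rewrite gt_eqF.
have dtn0 : dt != 0 by rewrite gt_eqF.
split => [h|<- i]; last first.
  by rewrite mxE; field; rewrite dxn0 dtn0.
apply/rowP => i; rewrite mxE; have /(congr1 (fun y => y * dt)) := h i.
rewrite divfK// => /eqP; rewrite subr_eq => /eqP ->.
by field; rewrite dxn0.
Qed.

Let coord_clampv_cont (f : R -> R) i : continuous (f \o clamp 0 alpha) ->
  continuous (fun u : 'rV[R]_N => f (clampv alpha u 0 i)).
Proof.
move=> cf; have -> : (fun u : 'rV[R]_N => f (clampv alpha u 0 i)) =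
    (f \o clamp 0 alpha) \o (fun u => u 0 i).
  by apply/funext => u /=; rewrite mxE.
by move=> u; apply: continuous_comp; [exact: coord_continuous|exact: cf].
Qed.

Lemma continuous_cell_flux i j :
  continuous (fun u => cell_flux (clampv alpha u) i j).
Proof.
have c1 k := coord_clampv_cont (i := k)
  (lipschitz_continuous_clamp (ltW alpha_gt0) (md_m1_lip Hmd)).
have c2 k := coord_clampv_cont (i := k)
  (lipschitz_continuous_clamp (ltW alpha_gt0) (md_m2_lip Hmd)).
have cp k : continuous (fun u : 'rV[R]_N => p (clampv alpha u 0 k)).
  apply: coord_clampv_cont => x; apply: continuous_comp.
    exact: continuous_clamp.
  exact: (continuous_deriv_cc alpha_gt0 (ltn0Sn 0) U1).
have cv : continuous (fun u => velocity (clampv alpha u) i j).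
  have cx k : continuous (fun u => xi (clampv alpha u) k).
    move=> u; apply: (cvgD (F := nbhs u) (f := fun u => p (clampv alpha u 0 k))
      (g := fun=> V (xc R k))); [exact: cp|exact: cvg_cst].
  move=> u; apply: (cvgMr_tmp (F := nbhs u)
    (f := fun u => - (xi (clampv alpha u) j - xi (clampv alpha u) i))).
  apply: (cvgN (F := nbhs u)); apply: (cvgB (F := nbhs u)); exact: cx.
move=> u; apply: (cvgD (F := nbhs u)); apply: (cvgM (F := nbhs u)).
- by apply: (cvgM (F := nbhs u)); [exact: c1|exact: c2].
- apply: (@continuous_max _ _ (fun u => velocity (clampv alpha u) i j) (fun=> 0)).
    exact: cv.
  exact: cst_continuous.
- by apply: (cvgM (F := nbhs u)); [exact: c1|exact: c2].
- apply: (@continuous_min _ _ (fun u => velocity (clampv alpha u) i j) (fun=> 0)).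
    exact: cv.
  exact: cst_continuous.
Qed.

Lemma balance_map_scheme : balance_map alpha balance.
Proof.
have lam_ge0 : 0 <= dt / dx R N by rewrite divr_ge0 ?ltW.
have balance_const c i : (forall i j, cell_flux (const_mx c) i j = 0) ->
    balance (const_mx c) 0 i = c.
  move=> F0; suff F k : face_flux (const_mx c) k = 0.
    by rewrite mxE !F subrr mulr0 addr0 mxE.
  by have [->//|[i' [j' [_ _ ->]]]] := face_fluxP k.
split.
- move=> u v i au av uv uvi; rewrite !mxE uvi lerD2l ler_wpM2l// lerB//.
    have [F|[i' [j' [ii _ F]]]] := face_fluxP i.+1; rewrite !F// cell_flux_le//.
    by move: ii => [] /val_inj <-; rewrite uvi.
  have [F|[i' [j' [ii ij F]]]] := face_fluxP i; rewrite !F// cell_flux_le//.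
  by move: ij; rewrite -ii => /val_inj ->; rewrite uvi.
- move=> u au; under eq_bigr do rewrite mxE.
  rewrite big_split/= -mulr_sumr.
  rewrite -(big_mkord xpredT (fun k => face_flux u k.+1 - face_flux u k)).
  by rewrite telescope_sumr// face_flux_last subrr mulr0 addr0.
- move=> i; have -> : 0 = const_mx 0 :> 'rV[R]_N by apply/rowP => j; rewrite !mxE.
  apply: balance_const => {}i j.
  by rewrite /Defs.cell_flux !mxE mobility1_0 !mul0r addr0.
- move=> i; apply: balance_const => {}i j.
  by rewrite /Defs.cell_flux !mxE mobility2_alpha !mulr0 !mul0r addr0.
- move=> i.
  have cF k : continuous (fun u => face_flux (clampv alpha u) k).
    have [F|[i' [j' [_ _ F]]]] := face_fluxP k.
      by under eq_fun do rewrite F; exact: cst_continuous.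
    by under eq_fun do rewrite F; exact: continuous_cell_flux.
  under eq_fun do rewrite mxE.
  move=> u; apply: (cvgD (F := nbhs u)).
    exact: (coord_clampv_cont (f := id) (continuous_clamp (a := 0) (b := alpha))).
  apply: (cvgMl_tmp (F := nbhs u)); apply: (cvgB (F := nbhs u)); exact: cF.
Qed.

Lemma J_spec rho : admissible alpha rho ->
  admissible alpha (J rho) /\ balance (J rho) = rho.
Proof.
move=> ar.
have [rho1 ar1 B1] := balance_solve (ltW alpha_gt0) balance_map_scheme ar.
have : exists u, admissible alpha u /\ scheme_step alpha m1 m2 U V dt rho u.
  by exists rho1; split => //; exact/scheme_stepE.
by move=> /(xgetPex 0)[aJ /scheme_stepE].
Qed.

Lemma J_unique rho rho1 : admissible alpha rho -> admissible alpha rho1 ->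
  balance rho1 = rho -> J rho = rho1.
Proof.
move=> ar ar1 B1; have [aJ BJ] := J_spec ar.
by apply: (balance_inj balance_map_scheme) => //; rewrite BJ.
Qed.

Lemma J_contraction rho eta : admissible alpha rho -> admissible alpha eta ->
  l1norm (J rho - J eta) <= l1norm (rho - eta).
Proof.
move=> ar ae; have [aJr Br] := J_spec ar; have [aJe Be] := J_spec ae.
by rewrite -{2}Br -{2}Be; exact: balance_contraction balance_map_scheme _ _ _ _.
Qed.

Definition energy rho : R := \sum_i (U (rho 0 i) + V (xc R i) * rho 0 i).

(** Summation by parts turns the work of the fluxes against the potential into
    the power dissipated at the faces. *)
Lemma flux_work (X F : nat -> R) n : F 0%N = 0 -> F n = 0 ->
  \sum_(i < n) X i * (F i.+1 - F i) = \sum_(i < n) F i.+1 * (X i - X i.+1).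
Proof.
move=> F0 Fn; apply/eqP; rewrite -subr_eq0 -sumrB.
under eq_bigr => i _.
  have -> : X i * (F i.+1 - F i) - F i.+1 * (X i - X i.+1) =
    X i.+1 * F i.+1 - X i * F i by ring.
  over.
rewrite -(big_mkord xpredT (fun k => X k.+1 * F k.+1 - X k * F k)).
by rewrite telescope_sumr// F0 Fn !mulr0 subrr.
Qed.

(** Convexity bounds the change of energy by the work of the fluxes, and every
    face dissipates; without dissipation there are no fluxes at all. *)
Lemma energy_dissipation rho : admissible alpha rho ->
  energy (J rho) <= energy rho /\ (energy rho <= energy (J rho) -> J rho = rho).
Proof.
move=> ar; have [au B] := J_spec ar; set u := J rho in au B *.
pose X k := if insub k is Some i then xi u i else 0.
have XE i : X i = xi u i by rewrite /X valK.
have face_power k : 0 <= face_flux u k.+1 * (X k - X k.+1) /\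
    (face_flux u k.+1 * (X k - X k.+1) = 0 -> face_flux u k.+1 = 0).
  have [->|[i [j [[->] ji F]]]] := face_fluxP k.+1; first by rewrite mul0r.
  have -> : X i - X i.+1 = velocity u i j * dx R N.
    by rewrite -ji !XE /Defs.velocity divfK ?gt_eqF// opprB.
  have [Fv Fv0] := @upwind_power R (m1 (u 0 i) * m2 (u 0 j))
    (m1 (u 0 j) * m2 (u 0 i)) (velocity u i j)
    (mulr_ge0 (m1_ge0 (au i)) (m2_ge0 (au j)))
    (mulr_ge0 (m1_ge0 (au j)) (m2_ge0 (au i))).
  rewrite F mulrA mulr_ge0 ?(ltW dx_gt0)//; split=> //.
  by move=> /eqP; rewrite mulf_eq0 [dx _ _ == _]gt_eqF// orbF => /eqP.
set D := \sum_(k < N) face_flux u k.+1 * (X k - X k.+1).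
have step i : u 0 i - rho 0 i =
    - (dt / dx R N * (face_flux u i.+1 - face_flux u i)).
  by rewrite -B mxE; ring.
have work : \sum_i xi u i * (u 0 i - rho 0 i) = - (dt / dx R N) * D.
  rewrite /D -flux_work ?face_flux_last// mulr_sumr.
  by apply: eq_bigr => i _; rewrite step XE; ring.
have E_work : energy u - energy rho <= - (dt / dx R N) * D.
  rewrite -work /energy -sumrB; apply: ler_sum => i _.
  have := convex_tangent alpha_gt0 U1 U3 U_convex (ar i) (au i).
  by rewrite /Defs.xi /= => ?; lra.
have lam_gt0 : 0 < dt / dx R N by rewrite divr_gt0.
have D_ge0 : 0 <= D by apply: sumr_ge0 => k _; case: (face_power k).
split.
  by rewrite -subr_le0 (le_trans E_work)// mulNr oppr_le0 mulr_ge0// ltW.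
move=> Eru; have D_le0 : D <= 0.
  rewrite -(pmulr_rle0 _ lam_gt0) -oppr_ge0 -mulNr (le_trans _ E_work)//.
  by rewrite subr_ge0.
have F0 (k : 'I_N) : face_flux u k.+1 = 0.
  have /eqP : D == 0 by rewrite eq_le D_le0.
  move=> /psumr_eq0P => /(_ _ k isT) h; apply: (face_power k).2; apply: h.
  by move=> i _; case: (face_power i).
apply/rowP => i; apply/eqP; rewrite -subr_eq0 step F0.
suff -> : face_flux u i = 0 by rewrite subrr mulr0 oppr0.
have [//|[j [_ [-> _ _]]]] := face_fluxP i; exact: F0.
Qed.

Lemma continuous_energy : continuous (fun u => energy (clampv alpha u)).
Proof.
have [_ cU _] := U1.
have c_id : continuous (@id R \o clamp 0 alpha) by exact: continuous_clamp.
move=> u; apply: (cvg_finite_sum (F := nbhs u)) => i.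
apply: (cvgD (F := nbhs u)).
  exact: (coord_clampv_cont (i := i) (continuous_comp_clamp (ltW alpha_gt0) cU)).
apply: (cvgMl_tmp (F := nbhs u)).
exact: (coord_clampv_cont (f := id) (i := i) c_id).
Qed.

Lemma J_iter_cvg rho : admissible alpha rho ->
  exists c, [/\ admissible alpha c, J c = c & iter n J rho @[n --> \oo] --> c].
Proof.
apply: (@dissipative_contraction_cvg R alpha N J
  (fun u => energy (clampv alpha u))).
- by move=> u /J_spec[].
- exact: J_contraction.
- exact: continuous_energy.
- move=> u au; have [aJ _] := J_spec au; rewrite !clampv_id//.
  exact: (energy_dissipation au).1.
- move=> u au; have [aJ _] := J_spec au; rewrite !clampv_id//.
  exact: (energy_dissipation au).2.
Qed.

Lemma Jinf_cvg rho : admissible alpha rho ->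
  iter n J rho @[n --> \oo] --> Jinf alpha m1 m2 U V dt rho /\
  J (Jinf alpha m1 m2 U V dt rho) = Jinf alpha m1 m2 U V dt rho.
Proof.
move=> /J_iter_cvg[c [_ Jc cvc]].
by rewrite /Jinf (cvg_lim _ cvc)//; exact: norm_hausdorff.
Qed.

Lemma Jinf_contraction rho eta : admissible alpha rho -> admissible alpha eta ->
  l1norm (Jinf alpha m1 m2 U V dt rho - Jinf alpha m1 m2 U V dt eta)
    <= l1norm (rho - eta).
Proof.
move=> ar ae; have [cr _] := Jinf_cvg ar; have [ce _] := Jinf_cvg ae.
have cre : l1norm (iter n J rho - iter n J eta) @[n --> \oo] -->
    l1norm (Jinf alpha m1 m2 U V dt rho - Jinf alpha m1 m2 U V dt eta).
  by apply: cvg_l1norm; exact: cvgB.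
have J_adm u : admissible alpha u -> admissible alpha (J u) by move=> /J_spec[].
rewrite -(cvg_lim _ cre)//; apply: limr_le; first exact: cvgP cre.
apply: nearW => n.
exact: (iter_contraction J_adm J_contraction).
Qed.

End scheme.

(** * Inverses of increasing functions, and the states they define *)

(** The Galois connection that makes T the inverse of q on (0,alpha), continued
    by 0 below the range of q and by alpha above it.  The truncated inverse of U'
    and the inverses of the U_eps' are both of this kind. *)
Definition inverse_pair (R : realType) (alpha : R) (q T : R -> R) : Prop :=
  (forall z, 0 <= T z <= alpha) /\
  forall t z, 0 < t < alpha -> (T z < t) = (z < q t) /\ (t < T z) = (q t < z).

Definition level_row (R : realType) (T V : R -> R) (N : nat) (C : R) : 'rV[R]_N :=
  \row_i T (C - V (xc R i)).

Lemma xc_itv (R : realType) (N : nat) (i : 'I_N) : 0 < xc R i < 1.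
Proof.
have iN := ltn_ord i.
have N0 : 0 < N%:R :> R by rewrite ltr0n (leq_ltn_trans _ iN).
have num_gt0 : 0 < i%:R + 2^-1 :> R by rewrite ltr_wpDl// invr_gt0.
rewrite /xc /dx divr_gt0//=.
rewrite ltr_pdivrMr// mul1r.
have : (i.+1)%:R <= N%:R :> R by rewrite ler_nat.
rewrite -addn1 natrD; lra.
Qed.

Section inverse_pair.
Context {R : realType} {alpha : R} {q T : R -> R}.
Hypothesis qT : inverse_pair alpha q T.
Implicit Types (t z w C : R).

Let T_ge0 z : 0 <= T z. Proof. by case/andP: (qT.1 z). Qed.
Let T_le z : T z <= alpha. Proof. by case/andP: (qT.1 z). Qed.

Lemma inverse_homo z w : z <= w -> T z <= T w.
Proof.
move=> zw; rewrite leNgt; apply/negP => Twz.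
have [Tt tT] := midf_lt Twz; set t := (T w + T z) / 2 in Tt tT.
have t_itv : 0 < t < alpha.
  by rewrite (le_lt_trans (T_ge0 w) Tt) (lt_le_trans tT (T_le z)).
have [h1 _] := qT.2 t w t_itv; have [_ h2] := qT.2 t z t_itv.
rewrite Tt in h1; rewrite tT in h2.
have := lt_trans (esym h2 : q t < z) (le_lt_trans zw (esym h1 : w < q t)).
by rewrite ltxx.
Qed.

Lemma inverse_root z : 0 < T z < alpha -> q (T z) = z.
Proof.
move=> Tz; have [h1 h2] := qT.2 (T z) z Tz; rewrite ltxx in h1; rewrite ltxx in h2.
by apply/eqP; rewrite eq_le !leNgt -h1 -h2.
Qed.

Lemma inverseK t : 0 < t < alpha -> T (q t) = t.
Proof.
move=> t_itv; have [h1 h2] := qT.2 t (q t) t_itv; rewrite !ltxx in h1 h2.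
by apply/eqP; rewrite eq_le !leNgt h1 h2.
Qed.

Lemma continuous_inverse : continuous T.
Proof.
move=> z; apply/cvgrPdist_lt => e e0.
have e20 : 0 < e / 2 by rewrite divr_gt0.
have below : \forall w \near z, T w < T z + e.
  have [Tz|Tz] := ltP (T z + e / 2) alpha; last first.
    by apply: (@nearW _ (nbhs z)) => w; have := T_le w; lra.
  have t_itv : 0 < T z + e / 2 < alpha by rewrite Tz ltr_wpDl.
  have zq : z < q (T z + e / 2).
    by have [<- _] := qT.2 _ z t_itv; rewrite ltrDl.
  have : \forall w \near z, w < q (T z + e / 2) by exact: lt_nbhsl.
  by apply: (filterS (F := nbhs z)) => w; have [<- _] := qT.2 _ w t_itv; lra.
have above : \forall w \near z, T z - e < T w.
  have [Tz|Tz] := ltP 0 (T z - e / 2); last first.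
    by apply: (@nearW _ (nbhs z)) => w; have := T_ge0 w; lra.
  have t_itv : 0 < T z - e / 2 < alpha by rewrite Tz; have := T_le z; lra.
  have zq : q (T z - e / 2) < z.
    by have [_ <-] := qT.2 _ z t_itv; lra.
  have : \forall w \near z, q (T z - e / 2) < w by exact: lt_nbhsr.
  by apply: (filterS (F := nbhs z)) => w; have [_ <-] := qT.2 _ w t_itv; lra.
near=> w; rewrite ltr_distl; apply/andP; split.
  by rewrite ltrBlDr; near: w.
by rewrite -ltrBlDr; near: w.
Unshelve. all: by end_near. Qed.

Section level.
Context {V : R -> R} {N : nat}.
Hypothesis V_ge0 : forall x, 0 <= x <= 1 -> 0 <= V x.
Hypothesis N_gt0 : (0 < N)%N.

Lemma level_row_adm C : admissible alpha (level_row T V N C).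
Proof. by move=> i; rewrite mxE; exact: qT.1. Qed.

Lemma has_mass_row M (rho : 'rV[R]_N) :
  has_mass M rho <-> \sum_i rho 0 i = N%:R * M.
Proof.
have N0 : N%:R != 0 :> R by rewrite pnatr_eq0 -lt0n.
by rewrite /has_mass /dx; split => [<-|->]; rewrite mulrA ?divff// ?mulVf// mul1r.
Qed.

(** Intermediate values: as V >= 0, the level q M gives at most the mass M, and
    adding all the V(x_i) to it gives at least M. *)
Lemma level_mass_exists M : 0 < M < alpha ->
  exists C, has_mass M (level_row T V N C).
Proof.
move=> M_itv.
pose mass C := \sum_i level_row T V N C 0 i.
have Vx (i : 'I_N) : 0 <= V (xc R i).
  by apply: V_ge0; have /andP[/ltW -> /ltW ->] := xc_itv R i.
pose W := \sum_(i < N) V (xc R i).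
have VW (i : 'I_N) : V (xc R i) <= W.
  by rewrite /W (bigD1 i)//= lerDl sumr_ge0.
have mass_cont : continuous mass.
  move=> C; apply: (cvg_finite_sum (F := nbhs C)) => i.
  under eq_fun do rewrite mxE.
  rewrite mxE; apply: (@cvg_comp _ _ _ (fun C => C - V (xc R i)) T).
    by apply: cvgB; [exact: cvg_id|exact: cvg_cst].
  exact: continuous_inverse.
have sumM : \sum_(i < N) M = N%:R * M.
  by rewrite sumr_const card_ord mulr_natl.
have low : mass (q M) <= N%:R * M.
  rewrite -sumM; apply: ler_sum => i _; rewrite mxE -{2}(inverseK M_itv).
  by rewrite inverse_homo// gerBl.
have high : N%:R * M <= mass (q M + W).
  rewrite -sumM; apply: ler_sum => i _; rewrite mxE -{1}(inverseK M_itv).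
  by rewrite inverse_homo// -addrA lerDl subr_ge0.
have qW : q M <= q M + W by rewrite lerDl sumr_ge0.
have mlh := le_trans low high.
have [|C _ massC] := IVT (v := N%:R * M) qW (continuous_subspaceT mass_cont).
  by rewrite (min_idPl mlh) (max_idPr mlh) low.
by exists C; apply/has_mass_row.
Qed.

(** Strict monotonicity in the level needs cells that are neither empty nor full. *)
Lemma level_mass_inj M C C' : (forall z, 0 < T z < alpha) ->
  has_mass M (level_row T V N C) -> has_mass M (level_row T V N C') -> C = C'.
Proof.
move=> T_in.
wlog CC' : C C' / C <= C'.
  move=> wl hC hC'; have [h|/ltW h] := leP C C'; first exact: wl.
  by apply/esym/wl.
move=> /has_mass_row hC /has_mass_row hC'; apply/eqP.
rewrite eq_le CC' leNgt; apply/negP => ltCC'.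
suff : \sum_i level_row T V N C 0 i < \sum_i level_row T V N C' 0 i.
  by rewrite hC hC' ltxx.
case: N N_gt0 => // n _; apply: ltr_sum => [|i _].
  by apply/hasP; exists ord0 => //; exact: mem_index_enum.
rewrite !mxE lt_neqAle inverse_homo ?lerD2r// andbT; apply/eqP => E.
have := ltCC'; rewrite -(ltrD2r (- V (xc R i))) -[X in X < _]inverse_root//.
by rewrite -[X in _ < X]inverse_root// E ltxx.
Qed.

End level.
End inverse_pair.

(** * Stability of inverses and of the states of given mass *)

Section inverse_cvg.
Context {R : realType} {alpha : R} {q0 T0 : R -> R} {I : Type} {F : set_system I}
  {FF : Filter F} {q T : I -> R -> R}.
Hypothesis q0T0 : inverse_pair alpha q0 T0.
Hypothesis qT : \forall e \near F, inverse_pair alpha (q e) (T e).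
Hypothesis q_cvg : forall t, 0 < t < alpha -> q e t @[e --> F] --> q0 t.

(** The strict inequalities of the Galois connection are stable under small
    perturbations of q t. *)
Lemma inverse_cvg z : T e z @[e --> F] --> T0 z.
Proof.
apply/cvgrPdist_lt => d d0; have d20 : 0 < d / 2 by rewrite divr_gt0.
have [T0_ge0 T0_le] := andP (q0T0.1 z).
have below : \forall e \near F, T e z < T0 z + d.
  have [Tz|Tz] := ltP (T0 z + d / 2) alpha; last first.
    by apply: filterS qT => e eT; case/andP: (eT.1 z) => _ h; lra.
  have t_itv : 0 < T0 z + d / 2 < alpha by rewrite Tz ltr_wpDl.
  have : z < q0 (T0 z + d / 2).
    by have [<- _] := q0T0.2 _ z t_itv; rewrite ltrDl.
  move=> /(cvgr_gt _ (q_cvg t_itv)); apply: filterS2 qT => e eT.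
  by have [<- _] := eT.2 _ z t_itv; lra.
have above : \forall e \near F, T0 z - d < T e z.
  have [Tz|Tz] := ltP 0 (T0 z - d / 2); last first.
    by apply: filterS qT => e eT; case/andP: (eT.1 z) => h _; lra.
  have t_itv : 0 < T0 z - d / 2 < alpha by rewrite Tz; lra.
  have : q0 (T0 z - d / 2) < z.
    by have [_ <-] := q0T0.2 _ z t_itv; lra.
  move=> /(cvgr_lt _ (q_cvg t_itv)); apply: filterS2 qT => e eT.
  by have [_ <-] := eT.2 _ z t_itv; lra.
near=> e; rewrite ltr_distl; apply/andP; split.
  by rewrite ltrBlDr; near: e.
by rewrite -ltrBlDr; near: e.
Unshelve. all: by end_near. Qed.

(** The level C need not be determined by the mass, so the levels C_e may fail to
    converge.  But for a fixed e all cells of the row of T_e at level C_e lie on the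
    same side of those of the row of T_e at level C.  Hence each cell differs by at
    most the difference of the totals, which tends to 0 since the second row
    converges to the row of T_0 at level C, of mass M. *)
Lemma level_row_cvg (V : R -> R) (N : nat) (M C : R) (Ce : I -> R) :
  (0 < N)%N -> has_mass M (level_row T0 V N C) ->
  (\forall e \near F, has_mass M (level_row (T e) V N (Ce e))) ->
  level_row (T e) V N (Ce e) @[e --> F] --> level_row T0 V N C.
Proof.
move=> N0 /(has_mass_row N0) hC hCe.
pose gap e := \sum_i (level_row T0 V N C 0 i - level_row (T e) V N C 0 i).
have row_C i : level_row (T e) V N C 0 i @[e --> F] --> level_row T0 V N C 0 i.
  by under eq_fun do rewrite mxE; rewrite mxE; exact: inverse_cvg.
have gap0 : gap e @[e --> F] --> (0 : R).
  have -> : 0 = \sum_(i < N) (level_row T0 V N C 0 i - level_row T0 V N C 0 i).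
    by rewrite big1// => i _; rewrite subrr.
  by apply: cvg_finite_sum => i; apply: cvgB => //; exact: cvg_cst.
have dist : \forall e \near F, forall i,
    `|level_row (T e) V N (Ce e) 0 i - level_row (T e) V N C 0 i| <= `|gap e|.
  apply: filterS2 qT hCe => e eT /(has_mass_row N0) he i.
  have -> : gap e = \sum_j (level_row (T e) V N (Ce e) 0 j -
      level_row (T e) V N C 0 j) by rewrite /gap !sumrB he hC.
  have [CeC|/ltW CeC] := leP C (Ce e).
    have pos j : 0 <= level_row (T e) V N (Ce e) 0 j - level_row (T e) V N C 0 j.
      by rewrite !mxE subr_ge0 (inverse_homo eT)// lerD2r.
    rewrite !ger0_norm ?sumr_ge0// [leRHS](bigD1 i)//= lerDl.
    by apply: sumr_ge0.
  have neg j : level_row (T e) V N (Ce e) 0 j - level_row (T e) V N C 0 j <= 0.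
    by rewrite !mxE subr_le0 (inverse_homo eT)// lerD2r.
  rewrite !ler0_norm ?sumr_le0// lerN2 [leLHS](bigD1 i)//= gerDl.
  by apply: sumr_le0.
apply: cvg_row => i.
have diff0 : level_row (T e) V N (Ce e) 0 i - level_row (T e) V N C 0 i
    @[e --> F] --> (0 : R).
  apply/cvgr0Pnorm_lt => d d0.
  have gd : \forall e \near F, `|gap e| < d by exact: (cvgr0Pnorm_lt _).1 gap0 d d0.
  by apply: filterS2 dist gd => e /(_ i); exact: le_lt_trans.
have : (level_row (T e) V N (Ce e) 0 i - level_row (T e) V N C 0 i) +
    level_row (T e) V N C 0 i @[e --> F] --> 0 + level_row T0 V N C 0 i.
  exact: cvgD.
by rewrite add0r; under eq_fun do rewrite subrK.
Qed.

End inverse_cvg.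

(** * The truncated inverse of U' *)

Lemma deriv_inv_eq (R : realType) (alpha : R) (U : R -> R) s :
  (forall s t, 0 < s -> s < t -> t < alpha ->
    (U^`())%classic s < (U^`())%classic t) ->
  0 < s < alpha -> deriv_inv alpha U ((U^`())%classic s) = s.
Proof.
move=> U_incr s_itv; apply: pinvKV; last by rewrite inE/= in_itv.
move=> x y; rewrite !inE/= !in_itv/= => /andP[x0 xa] /andP[y0 ya] Uxy.
have [xy|yx|//] := ltgtP x y.
  by have := U_incr _ _ x0 xy ya; rewrite Uxy ltxx.
by have := U_incr _ _ y0 yx xa; rewrite Uxy ltxx.
Qed.

Section T_inv.
Context {R : realType} {alpha : R} {U : R -> R}.
Hypotheses (alpha_gt0 : 0 < alpha) (U1 : Ck_cc 1 0 alpha U).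
Let p := deriv_cc 0 alpha U.
Hypothesis p_incr : forall s t, 0 <= s -> s < t -> t <= alpha -> p s < p t.

Lemma T_inv_in z : p 0 < z < p alpha ->
  0 < T_inv alpha U z < alpha /\ p (T_inv alpha U z) = z.
Proof.
move=> /andP[pz zp]; rewrite /T_inv leNgt zp/= leNgt pz/=.
have p_cont : continuous p by exact: (continuous_deriv_cc alpha_gt0 (ltn0Sn 0) U1).
have pp := ltW (lt_trans pz zp).
have [|s /itvP s_itv ps] := IVT (v := z) (ltW alpha_gt0) (continuous_subspaceT p_cont).
  by rewrite (min_idPl pp) (max_idPr pp) !ltW.
have s0 : 0 < s.
  rewrite lt_neqAle s_itv andbT; apply/eqP => s0.
  by move: pz; rewrite -ps -s0 ltxx.
have sa : s < alpha.
  rewrite lt_neqAle s_itv andbT; apply/eqP => sa.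
  by move: zp; rewrite -ps sa ltxx.
have s_in : 0 < s < alpha by rewrite s0.
suff -> : deriv_inv alpha U z = s by [].
rewrite -ps /p deriv_cc_in// deriv_inv_eq// => x y x0 xy ya.
have x_in : 0 < x < alpha by rewrite x0 (lt_trans xy).
have y_in : 0 < y < alpha by rewrite ya (lt_trans x0).
by rewrite -(deriv_cc_in U x_in) -(deriv_cc_in U y_in) p_incr// ltW.
Qed.

Variant T_inv_spec z : R -> Type :=
| TInvHigh of p alpha <= z : T_inv_spec z alpha
| TInvLow of z <= p 0 : T_inv_spec z 0
| TInvMid t of 0 < t < alpha & p t = z : T_inv_spec z t.

Lemma T_invP z : T_inv_spec z (T_inv alpha U z).
Proof.
have [pz|zp] := leP (p alpha) z.
  by have -> : T_inv alpha U z = alpha; [rewrite /T_inv pz|constructor].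
have [zp0|pz] := leP z (p 0).
  have -> : T_inv alpha U z = 0; last by constructor.
  by rewrite /T_inv leNgt zp/= zp0.
have zz : p 0 < z < p alpha by rewrite pz.
by have [t_in pt] := T_inv_in zz; constructor.
Qed.

Lemma inverse_pair_T_inv : inverse_pair alpha p (T_inv alpha U).
Proof.
have a0 := ltW alpha_gt0.
split=> [z|t z /andP[t0 ta]].
  by case: T_invP => [_|_|t /andP[/ltW -> /ltW ->]//]; rewrite lexx a0.
have pt0 := p_incr (lexx 0) t0 (ltW ta).
have pta := p_incr (ltW t0) ta (lexx alpha).
case: T_invP => [pz|zp|s /andP[s0 sa] <-].
- have ptz := lt_le_trans pta pz.
  by rewrite (lt_gtF ta) (lt_gtF ptz) ta ptz.
- have zpt := le_lt_trans zp pt0.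
  by rewrite (lt_gtF t0) (lt_gtF zpt) t0 zpt.
have [st|ts|->] := ltgtP s t; last by rewrite !ltxx.
- by have pst := p_incr (ltW s0) st (ltW ta); rewrite pst (lt_gtF pst).
- by have pts := p_incr (ltW t0) ts (ltW sa); rewrite pts (lt_gtF pts).
Qed.

End T_inv.

(** * Equilibria of the scheme *)

Section equilibrium.
Context {R : realType} {alpha : R} {m m1 m2 U V : R -> R} {N : nat} {dt : R}.
Hypotheses (alpha_gt0 : 0 < alpha) (m_0 : m 0 = 0) (m_alpha : m alpha = 0).
Hypothesis m_pos : forall s, 0 < s < alpha -> 0 < m s.
Hypothesis Hmd : mobility_decomposition alpha m m1 m2.
Hypotheses (U1 : Ck_cc 1 0 alpha U) (U3 : Ck_oo 3 0 alpha U).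
Hypothesis U_convex : forall s, 0 < s < alpha -> 0 <= (U^`(2)) s.
Hypotheses (N_gt0 : (0 < N)%N) (dt_gt0 : 0 < dt).
Let p := deriv_cc 0 alpha U.
Hypothesis p_incr : forall s t, 0 <= s -> s < t -> t <= alpha -> p s < p t.

(** The potential of a cell exceeds the level C only if the cell is empty, and
    falls short of C only if the cell is full.  So wherever the velocity does not
    vanish, the upwind mobility does. *)
Lemma rho_eq_stationary C :
  J alpha m1 m2 U V dt (rho_eq alpha U V N C) = rho_eq alpha U V N C.
Proof.
set rho := rho_eq alpha U V N C.
have rho_adm : admissible alpha rho.
  exact: (level_row_adm (V := V) (N := N)
    (inverse_pair_T_inv alpha_gt0 U1 p_incr) C).
have high (i : 'I_N) : C < xi alpha U V rho i -> m1 (rho 0 i) = 0.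
  rewrite /xi mxE; case: (T_invP alpha_gt0 U1 p_incr).
  - by move=> h; rewrite ltNge -lerBrDr h.
  - by move=> _ _; exact: (mobility1_0 alpha_gt0 m_0 m_pos Hmd).
  - by move=> t _ pt; rewrite pt subrK ltxx.
have low (i : 'I_N) : xi alpha U V rho i < C -> m2 (rho 0 i) = 0.
  rewrite /xi mxE; case: (T_invP alpha_gt0 U1 p_incr).
  - by move=> _ _; exact: (mobility2_alpha alpha_gt0 m_alpha m_pos Hmd).
  - by move=> h; rewrite ltNge -lerBlDr h.
  - by move=> t _ pt; rewrite pt subrK ltxx.
have flux_term (i j : 'I_N) : xi alpha U V rho j < xi alpha U V rho i ->
    m1 (rho 0 i) * m2 (rho 0 j) = 0.
  move=> xji; have [Ci|Ci] := ltP C (xi alpha U V rho i).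
    by rewrite high// mul0r.
  by rewrite low ?mulr0// (lt_le_trans xji).
have dx_gt0 : 0 < dx R N by rewrite invr_gt0 ltr0n.
have F0 k : face_flux alpha m1 m2 U V rho k = 0.
  have [//|[i [j [_ _ ->]]]] := @face_fluxP R alpha m1 m2 U V N k.
  rewrite /cell_flux /velocity.
  have [xij|xji|->] := ltgtP (xi alpha U V rho i) (xi alpha U V rho j).
  - rewrite (flux_term _ _ xij) mul0r addr0 (max_idPr _) ?mulr0//.
    by rewrite mulNr oppr_le0 divr_ge0 ?subr_ge0// ltW.
  - rewrite (flux_term _ _ xji) mul0r add0r (min_idPr _) ?mulr0//.
    by rewrite opprB divr_ge0 ?subr_ge0// ltW.
  - by rewrite subrr oppr0 mul0r maxxx minxx !mulr0 addr0.
apply: (J_unique alpha_gt0 m_0 m_alpha m_pos Hmd U1 U3 U_convex) => //.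
by apply/rowP => i; rewrite mxE !F0 subrr mulr0 addr0.
Qed.

Lemma Jinf_rho_eq C :
  Jinf alpha m1 m2 U V dt (rho_eq alpha U V N C) = rho_eq alpha U V N C.
Proof.
have iterE n : iter n (J alpha m1 m2 U V dt) (rho_eq alpha U V N C) =
    rho_eq alpha U V N C by elim: n => //= n ->; exact: rho_eq_stationary.
rewrite /Jinf; under eq_fun do rewrite iterE.
by apply: cvg_lim; [exact: norm_hausdorff|exact: cvg_cst].
Qed.

End equilibrium.

(** * The regularised problem *)

Section Phi.
Context {R : realType} {alpha : R} {m V U : R -> R} {s0 : R}.
Hypothesis Hst : standing alpha m V U s0.
Let mu := @lebesgue_measure R.
Let f (t : R) : R := m t * (U^`(2))%classic t.

Let f_int a b : 0 < a -> b < alpha -> mu.-integrable `[a, b] (EFin \o f).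
Proof.
move=> a0 ba; apply: integrableS (st_mU_L1 Hst) => // x /=; rewrite !in_itv/=.
by move=> /andP[ax xb]; rewrite (lt_le_trans a0 ax) (le_lt_trans xb ba).
Qed.

Lemma continuous_mobility s : 0 < s < alpha -> {for s, continuous m}.
Proof. exact: (Ck_oo_continuous (st_m_C1 Hst) (ltn0Sn 0)). Qed.

Lemma continuous_U2 s : 0 < s < alpha -> {for s, continuous (U^`(2))%classic}.
Proof. exact: (Ck_oo_continuous (st_U_C3 Hst) (ltnSn 2)). Qed.

(** On the compact subintervals of (0,alpha) the oriented integral is a difference of
    integrals with a common lower end. *)
Lemma derive_Phi s : 0 < s < alpha ->
  ((Phi m U s0)^`())%classic s = m s * (U^`(2))%classic s.
Proof.
move=> s_in; have /andP[sgt0 sa] := s_in.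
have /andP[s0_gt0 s0a] := st_s0 Hst.
pose a := Num.min s s0 / 2.
have min_gt0 : 0 < Num.min s s0 by rewrite lt_min sgt0.
have a_gt0 : 0 < a by rewrite divr_gt0.
have a_min : a < Num.min s s0 by rewrite ltr_pdivrMr// mulr_natr mulr2n ltrDl.
have [as_ as0] : a < s /\ a < s0 by move: a_min; rewrite lt_min => /andP[].
pose G (y : R) : R := \int[mu]_(t in `[a, y]) f t.
have GB y z : a < y -> y <= z -> z < alpha ->
    \int[mu]_(t in `[y, z]) f t = G z - G y.
  move=> ay yz za.
  rewrite /G Rintegral_itvB ?bnd_simp ?f_int ?(ltW ay)//.
  rewrite Rintegral_itv_obnd_cbnd//; apply: integrableS (f_int a_gt0 za) => //.
  move=> x /=; rewrite !in_itv/= => /andP[yx ->]; rewrite andbT.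
  by rewrite ltW// (lt_trans ay).
have PhiG : \near s, Phi m U s0 s = G s - G s0.
  near=> y.
  have ay : a < y by near: y; exact: lt_nbhsr.
  have ya : y < alpha by near: y; exact: lt_nbhsl.
  rewrite /Phi; case: leP => ys0; first by rewrite GB.
  by rewrite GB ?(ltW ys0)// opprB.
have [u su ua] : exists2 u, s < u & u < alpha.
  by exists ((s + alpha) / 2); [exact: (midf_lt sa).1|exact: (midf_lt sa).2].
have f_cont : {for s, continuous f}.
  by apply: cvgM; [exact: continuous_mobility|exact: continuous_U2].
have [dG GE] := continuous_FTC1_closed su (f_int a_gt0 ua) as_ f_cont.
have dG' : is_derive s 1 (fun y => G y - G s0) (f s).
  have : is_derive s 1 G (f s) by rewrite -GE derive1E; exact: derivableP.
  by move=> dGs; apply: is_derive_eq; rewrite subr0.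
have : is_derive s 1 (Phi m U s0) (f s).
  apply: near_eq_is_derive dG'; near=> y; apply/esym; near: y; exact: PhiG.
by move=> dP; rewrite derive1E; exact: derive_val.
Unshelve. all: by end_near. Qed.

Lemma derive_Phi_ge0 s : 0 < s < alpha -> 0 <= ((Phi m U s0)^`())%classic s.
Proof.
move=> sa; rewrite derive_Phi//.
by rewrite mulr_ge0 ?(ltW (st_m_pos Hst sa))// (st_U_convex Hst).
Qed.

End Phi.

(** A function growing at least like [c * ln] is unbounded below at 0: it loses at
    least [c / 2] each time the argument is halved. *)
Lemma log_growth_unbounded (R : realType) (alpha c : R) (q : R -> R) :
  0 < alpha -> 0 < c ->
  (forall s t, 0 < s -> s < t -> t < alpha -> c * (t - s) / t <= q t - q s) ->
  forall z, exists2 s, 0 < s < alpha & q s < z.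
Proof.
move=> a0 c0 q_growth z; pose x n : R := alpha / 2 / 2 ^+ n.
have x_gt0 n : 0 < x n by rewrite !divr_gt0// exprn_gt0.
have x_half n : x n.+1 = x n / 2.
  by rewrite /x exprS invfM mulrA mulrAC.
have x_lt n : x n < alpha.
  elim: n => [|n]; first by rewrite /x expr0 divr1 ltr_pdivrMr// ltr_pMr// ltr1n.
  by apply: lt_trans; rewrite x_half ltr_pdivrMr// ltr_pMr// ltr1n.
have q_step n : q (x n.+1) <= q (x 0%N) - n.+1%:R * (c / 2).
  have half k : q (x k.+1) <= q (x k) - c / 2.
    have xk : x k.+1 < x k by rewrite x_half ltr_pdivrMr// ltr_pMr// ltr1n.
    have := q_growth _ _ (x_gt0 k.+1) xk (x_lt k).
    have -> : c * (x k - x k.+1) / x k = c / 2.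
      by rewrite x_half; field; rewrite gt_eqF.
    by lra.
  elim: n => [|n IH]; first by rewrite mul1r.
  by apply: le_trans (half _) _; rewrite -(natr1 n.+1) mulrDl mul1r; lra.
have c20 : 0 < c / 2 by rewrite divr_gt0.
pose n := Num.truncn `|(q (x 0%N) - z) / (c / 2)|.
exists (x n.+1); first by rewrite x_gt0 x_lt.
apply: le_lt_trans (q_step n) _.
rewrite ltrBlDr -ltrBlDl -ltr_pdivrMr//.
apply: le_lt_trans (ler_norm _) _.
exact: truncnS_gt.
Qed.

(** By the intermediate value theorem U' is onto, so that the partial inverse
    is defined by its equation everywhere. *)
Lemma deriv_inv_spec (R : realType) (alpha : R) (U : R -> R) :
  (forall s t, 0 < s -> s < t -> t < alpha ->
    (U^`())%classic s < (U^`())%classic t) ->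
  (forall s, 0 < s < alpha -> {for s, continuous (U^`())%classic}) ->
  (forall z, exists2 s, 0 < s < alpha & (U^`())%classic s < z) ->
  (forall z, exists2 s, 0 < s < alpha & z < (U^`())%classic s) ->
  (forall z, 0 < deriv_inv alpha U z < alpha) /\
  inverse_pair alpha (U^`())%classic (deriv_inv alpha U).
Proof.
move=> q_incr q_cont q_low q_high.
set q := (U^`())%classic in q_incr q_cont q_low q_high *.
have invP z : exists2 s, 0 < s < alpha & q s = z /\ deriv_inv alpha U z = s.
  have [s /andP[sgt0 sa] qs] := q_low z; have [t /andP[t0 ta] qt] := q_high z.
  have st : s < t.
    rewrite ltNge; apply/negP; rewrite le_eqVlt => /predU1P[E|ts].
      by have := lt_trans qs qt; rewrite E ltxx.
    by have := lt_trans (lt_trans qs qt) (q_incr _ _ t0 ts sa); rewrite ltxx.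
  have q_st : {within `[s, t], continuous q}.
    apply: continuous_in_subspaceT => x; rewrite inE/= in_itv/= => /andP[sx xt].
    by apply: q_cont; rewrite (lt_le_trans sgt0 sx) (le_lt_trans xt ta).
  have qq := ltW (lt_trans qs qt).
  have [|r] := IVT (v := z) (ltW st) q_st.
    by rewrite (min_idPl qq) (max_idPr qq) !ltW.
  rewrite in_itv/= => /andP[sr rt] qr.
  have r_in : 0 < r < alpha by rewrite (lt_le_trans sgt0 sr) (le_lt_trans rt ta).
  by exists r => //; split => //; rewrite -qr; exact: deriv_inv_eq.
split=> [z|]; first by have [s s_in [_ ->]] := invP z.
split=> [z|t z /andP[t0 ta]].
  by have [s /andP[/ltW s0 /ltW sa] [_ ->]] := invP z; rewrite s0.
have [s /andP[sgt0 sa] [<- ->]] := invP z.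
have [st|ts|->] := ltgtP s t; last by rewrite !ltxx.
  by have qst := q_incr _ _ sgt0 st ta; rewrite qst (lt_gtF qst).
by have qts := q_incr _ _ t0 ts sa; rewrite qts (lt_gtF qts).
Qed.

Section regularisation.
Context {R : realType} {alpha : R} {m V U : R -> R} {s0 : R}.
Context {kappa : R -> R} {Phie me Ue : R -> R -> R}.
Hypothesis Hst : standing alpha m V U s0.
Hypothesis Hre : regularisation alpha m U s0 kappa Phie me Ue.
Let alpha_gt0 := st_alpha Hst.

Lemma Ue2_ge e s : 0 < e <= 1 -> 0 < s < alpha ->
  e / me e s <= ((Ue e)^`(2))%classic s.
Proof.
move=> e_in s_in; rewrite (re_U_eq Hre e_in s_in).
rewrite ler_pM2r ?invr_gt0 ?(re_m_pos Hre)//.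
have /andP[h _] := re_Phi_bounds Hre e_in s_in; apply: le_trans h.
rewrite /g_eps lerDr le_min (derive_Phi_ge0 Hst s_in)/=.
by rewrite invr_ge0 ltW// (re_kappa_pos Hre).
Qed.

Lemma Ue1_incr e s t : 0 < e <= 1 -> 0 < s -> s < t -> t < alpha ->
  ((Ue e)^`())%classic s < ((Ue e)^`())%classic t.
Proof.
move=> e_in sgt0 st ta; have [U3 _] := re_U_C31 Hre e_in.
have [c /andP[sc ct] E] := Ck_oo_MVT U3 isT sgt0 st ta.
have c_in : 0 < c < alpha by rewrite (lt_trans sgt0 sc) (lt_trans ct ta).
rewrite -subr_gt0 E mulr_gt0 ?subr_gt0//.
apply: lt_le_trans (Ue2_ge e_in c_in); case/andP: (e_in) => e0 _.
by rewrite divr_gt0// (re_m_pos Hre).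
Qed.

(** The regularised mobility vanishes linearly at both ends, so that the second
    derivative of U_eps is at least a multiple of the inverse distance to them. *)
Lemma Ue1_growth e : 0 < e <= 1 -> exists2 c, 0 < c &
  forall s t, 0 < s -> s < t -> t < alpha ->
    c * (t - s) / t <= ((Ue e)^`())%classic t - ((Ue e)^`())%classic s /\
    c * (t - s) / (alpha - s) <=
      ((Ue e)^`())%classic t - ((Ue e)^`())%classic s.
Proof.
move=> e_in; have [U3 _] := re_U_C31 Hre e_in; have /andP[e0 _] := e_in.
have [L L0 mL] := Ck_cc_lipschitz alpha_gt0 (ltn0Sn 0) (re_m_C1 Hre e_in).
have end0 : (0 : R) <= 0 <= alpha by rewrite lexx ltW.
have enda : 0 <= alpha <= alpha by rewrite lexx ltW.
exists (e / L) => [|s t sgt0 st ta]; first by rewrite divr_gt0.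
have [c /andP[sc ct] ->] := Ck_oo_MVT U3 isT sgt0 st ta.
have c_in : 0 < c < alpha by rewrite (lt_trans sgt0 sc) (lt_trans ct ta).
have /andP[c0 ca] := c_in; have c_in' : 0 <= c <= alpha by rewrite !ltW.
have mc := re_m_pos Hre e_in c_in.
have bound d : 0 < d -> me e c <= L * d -> e / L * (t - s) / d <=
    ((Ue e)^`(2))%classic c * (t - s).
  move=> d0 md; rewrite mulrAC ler_pM2r ?subr_gt0//.
  apply: le_trans (Ue2_ge e_in c_in).
  by rewrite -mulrA -invfM ler_pM2l// lef_pV2 ?posrE// ?mulr_gt0// mulrC.
split; apply: bound.
- exact: lt_trans st.
- have := mL _ _ end0 c_in'; rewrite (re_m_0 Hre e_in) !subr0 !gtr0_norm// => h.
  by rewrite (le_trans h)// ler_pM2l// ltW.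
- by rewrite subr_gt0 (lt_trans st).
- have := mL _ _ c_in' enda; rewrite (re_m_alpha Hre e_in) sub0r normrN.
  rewrite gtr0_norm// gtr0_norm ?subr_gt0// => h.
  by rewrite (le_trans h)// ler_pM2l// lerB// ltW.
Qed.

Lemma deriv_inv_Ue e : 0 < e <= 1 ->
  (forall z, 0 < deriv_inv alpha (Ue e) z < alpha) /\
  inverse_pair alpha ((Ue e)^`())%classic (deriv_inv alpha (Ue e)).
Proof.
move=> e_in; have [U3 _] := re_U_C31 Hre e_in.
have [c c0 growth] := Ue1_growth e_in.
set q := ((Ue e)^`())%classic in growth *.
apply: deriv_inv_spec.
- by move=> s t; exact: Ue1_incr.
- move=> s s_in; have := Ck_oo_continuous U3 (ltnW (ltnSn 2)) s_in.
  by rewrite derive1n1.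
- apply: (log_growth_unbounded alpha_gt0 c0) => s t sgt0 st ta.
  exact: (growth _ _ sgt0 st ta).1.
(* reflection exchanges the two ends *)
- move=> z; pose r (x : R) := - q (alpha - x).
  have [|x /andP[x0 xa] rx] :=
    @log_growth_unbounded R alpha c r alpha_gt0 c0 _ (- z).
    move=> s t sgt0 st ta.
    have h0 : 0 < alpha - t by rewrite subr_gt0.
    have h1 : alpha - t < alpha - s by rewrite ltrD2l ltrN2.
    have h2 : alpha - s < alpha by rewrite gtrBl.
    have [_] := growth _ _ h0 h1 h2; rewrite /r.
    have -> : alpha - s - (alpha - t) = t - s by ring.
    have -> : alpha - (alpha - t) = t by ring.
    by move=> h; rewrite opprK [leRHS]addrC.
  exists (alpha - x); first by rewrite subr_gt0 xa gtrBl.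
  by rewrite -ltrN2.
Qed.

(** Locally uniformly in (0,alpha), Phi_eps' tends to Phi' = m U'' by assumption
    and m_eps to m by joint continuity.  Compactness of [a,b] makes the local
    estimates for the quotient uniform. *)
Lemma Ue2_cvg a b d : 0 < a -> a <= b -> b < alpha -> 0 < d ->
  \forall e \near 0^'+, forall s, a <= s <= b ->
    `|((Ue e)^`(2))%classic s - (U^`(2))%classic s| < d.
Proof.
move=> a0 ab ba d0.
pose a' := a / 2; pose b' := (b + alpha) / 2.
have [a'0 a'a] : 0 < a' /\ a' < a.
  by rewrite /a' divr_gt0// ltr_pdivrMr// ltr_pMr// ltr1n.
have [bb' b'a] : b < b' /\ b' < alpha.
  by split; [exact: (midf_lt ba).1|exact: (midf_lt ba).2].
have := (near_covering_withinP _).2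
  ((compact_near_coveringP _).1 (@segment_compact R a b)).
move=> /(_ R 0^'+ (fun e s =>
  `|((Ue e)^`(2))%classic s - (U^`(2))%classic s| < d)) cover.
suff : \forall e \near 0^'+, `[a, b]%classic `<=`
    [set s | `|((Ue e)^`(2))%classic s - (U^`(2))%classic s| < d].
  by apply: filterS => e h s s_ab; apply: h; rewrite /= in_itv.
apply: cover => x; rewrite /= in_itv/= => /andP[ax xb].
have x_in : 0 < x < alpha by rewrite (lt_le_trans a0 ax) (le_lt_trans xb ba).
have a'x := lt_le_trans a'a ax; have xb' := le_lt_trans xb bb'.
pose G := filter_prod (nbhs x) (0^'+ : set_system R).
have s_near : \forall p \near G, a' < p.1 < b'.
  exists ([set s | a' < s < b'], setT); last by case=> s e [].
  split; last exact: filterT.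
  by near=> s; apply/andP; split; near: s; [exact: lt_nbhsr|exact: lt_nbhsl].
have e_near : \forall p \near G, 0 < p.2 < 1.
  exists (setT, [set e : R | 0 < e < 1]); last by case=> s e [].
  split; first exact: filterT.
  by near=> e; apply/andP; split; near: e; [exact: nbhs_right_gt|exact: nbhs_right_lt].
have fst_G (g : R -> R) : {for x, continuous g} -> g p.1 @[p --> G] --> g x.
  move=> gx; apply: (@cvg_comp _ _ _ fst g G (nbhs x) _ _ gx).
  exact: cvg_fst.
have U2x := fst_G _ (continuous_U2 Hst x_in).
have m_G : me p.2 p.1 @[p --> G] --> m x.
  have x_cc : 0 <= x <= alpha by rewrite !ltW//; case/andP: x_in.
  rewrite -(re_m_zero Hre x_cc).
  have /subspace_continuousP/(_ ((0 : R), x)) := re_m_joint_cont Hre.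
  have h : (`[(0 : R), 1] `*` `[0, alpha])%classic ((0 : R), x).
    by split; rewrite /= in_itv/= ?lexx ?ler01.
  move=> /(_ h) jc.
  apply: (@cvg_comp _ _ _ (fun p : R * R => (p.2, p.1))
    (fun p : R * R => me p.1 p.2) G _ _ _ jc).
  move=> P [[P1 P2] /= [P1_0 P2_x] sub].
  have : \forall p \near G, P1 p.2 /\ P2 p.1.
    exists (P2, P1); last by case=> s e [].
    split=> //=; rewrite /at_right /within/=.
    by apply: filterS P1_0.
  apply: filterS3 s_near e_near => -[s e] /= /andP[a's sb'] /andP[e0 e1] [P1e P2s].
  apply: (sub (e, s)) => //.
  split; rewrite /= in_itv/= !ltW// ?(lt_trans a'0 a's)//.
  exact: lt_trans b'a.
have Phi_G : ((Phie p.2)^`())%classic p.1 @[p --> G] -->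
    m x * (U^`(2))%classic x.
  have mU : m p.1 * (U^`(2))%classic p.1 @[p --> G] --> m x * (U^`(2))%classic x.
    by apply: cvgM => //; apply: fst_G; exact: (continuous_mobility Hst x_in).
  have unif := re_Phi_cvg Hre a'0 (lt_trans a'x xb') b'a (j := 1%N) isT.
  have diff0 : ((Phie p.2)^`())%classic p.1 - m p.1 * (U^`(2))%classic p.1
      @[p --> G] --> (0 : R).
    apply/cvgr0Pnorm_lt => r r0.
    have near_e : \forall e \near 0^'+, forall s, `[a', b']%classic s ->
        `|((Phi m U s0)^`())%classic s - ((Phie e)^`())%classic s| < r.
      have nbhs_unif : nbhs ((Phi m U s0)^`(1)%classic : {uniform` `[a', b'] -> R})
          [set h : R -> R | forall s, `[a', b']%classic s ->
            ball ((Phi m U s0)^`(1)%classic s) r (h s)].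
        apply/uniform_nbhs; exists [set xy : R * R | ball xy.1 r xy.2].
        by split; [exact: (entourage_ball R (PosNum r0))|move=> h hs s; exact: hs].
      have : \forall e \near 0^'+, forall s, `[a', b']%classic s ->
          ball ((Phi m U s0)^`(1)%classic s) r ((Phie e)^`(1)%classic s).
        exact: unif _ nbhs_unif.
      apply: filterS => e he s hs.
      by have := he s hs; rewrite !derive1n1.
    have : \forall p \near G, forall s, `[a', b']%classic s ->
        `|((Phi m U s0)^`())%classic s - ((Phie p.2)^`())%classic s| < r.
      exact: (cvg_snd near_e).
    apply: filterS2 s_near => -[s e] /= /andP[a's sb'] /(_ s).
    rewrite in_itv/= !ltW// => /(_ isT).
    rewrite distrC (derive_Phi Hst)//.
    by rewrite (lt_trans a'0 a's) (lt_trans sb' b'a).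
  have : (((Phie p.2)^`())%classic p.1 - m p.1 * (U^`(2))%classic p.1) +
      m p.1 * (U^`(2))%classic p.1 @[p --> G] --> 0 + m x * (U^`(2))%classic x.
    exact: cvgD.
  by rewrite add0r; under eq_fun do rewrite subrK.
have mx := st_m_pos Hst x_in.
have quot : ((Phie p.2)^`())%classic p.1 / me p.2 p.1 - (U^`(2))%classic p.1
    @[p --> G] --> (0 : R).
  have -> : 0 = m x * (U^`(2))%classic x / m x - (U^`(2))%classic x.
    by rewrite mulrAC divff ?gt_eqF// mul1r subrr.
  by apply: cvgB => //; apply: cvgM => //; apply: cvgV => //; rewrite gt_eqF.
have : \forall p \near G, `|((Phie p.2)^`())%classic p.1 / me p.2 p.1
    - (U^`(2))%classic p.1| < d by exact: (cvgr0Pnorm_lt _).1 quot d d0.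
apply: filterS3 s_near e_near => p /andP[a's sb'] /andP[e0 e1] h _.
suff : `|((Ue p.2)^`(2))%classic p.1 - (U^`(2))%classic p.1| < d by [].
rewrite (re_U_eq Hre)//; first by rewrite e0 ltW.
by rewrite (lt_trans a'0 a's) (lt_trans sb' b'a).
Unshelve. all: by end_near. Qed.

(** Both derivatives agree at alpha/2, so their distance at t is at most the
    distance of the second derivatives in between, times alpha. *)
Lemma Ue1_cvg t : 0 < t < alpha ->
  ((Ue e)^`())%classic t @[e --> 0^'+] --> deriv_cc 0 alpha U t.
Proof.
move=> t_in; have /andP[t0 ta] := t_in; pose h := alpha / 2.
have [h0 ha] : 0 < h /\ h < alpha.
  by rewrite /h divr_gt0// ltr_pdivrMr// ltr_pMr// ltr1n.
have h_in : 0 < h < alpha by rewrite h0.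
pose a := Num.min t h; pose b := Num.max t h.
have a0 : 0 < a by rewrite lt_min t0.
have ab : a <= b by rewrite le_max !ge_min lexx.
have ba : b < alpha by rewrite gt_max ta.
apply/cvgrPdist_lt => d d0.
have da0 : 0 < d / alpha by rewrite divr_gt0.
have close := Ue2_cvg a0 ab ba da0.
near=> e.
have e_in : 0 < e <= 1.
  apply/andP; split; near: e; first exact: nbhs_right_gt.
  exact: nbhs_right_le.
have close_e : forall s, a <= s <= b ->
  `|((Ue e)^`(2))%classic s - (U^`(2))%classic s| < d / alpha by near: e.
have [U3 _] := re_U_C31 Hre e_in.
rewrite deriv_cc_in// distrC.
pose w (s : R) := ((Ue e)^`())%classic s - (U^`())%classic s.
have wh : w h = 0 by rewrite /w (re_dU_mid Hre e_in) subrr.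
have w_step x y : a <= x -> x < y -> y <= b -> `|w y - w x| < d.
  move=> ax xy yb.
  have in_ab s : x <= s <= y -> a <= s <= b /\ 0 < s < alpha.
    move=> /andP[xs sy]; have as_ := le_trans ax xs; have sb := le_trans sy yb.
    by rewrite as_ sb (lt_le_trans a0 as_) (le_lt_trans sb ba).
  have dw s : x <= s <= y -> is_derive s 1 w
      (((Ue e)^`(2))%classic s - (U^`(2))%classic s).
    move=> /in_ab[_ s_in].
    have := Ck_oo_is_derive U3 (ltnW (ltnSn 2)) s_in.
    have := Ck_oo_is_derive (st_U_C3 Hst) (ltnW (ltnSn 2)) s_in.
    by rewrite !derive1n1 => d1 d2; exact: is_deriveB.
  have [||c] := @MVT R w (fun s => ((Ue e)^`(2))%classic s - (U^`(2))%classic s)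
      x y xy.
  - move=> s; rewrite in_itv/= => /andP[/ltW xs /ltW sy].
    by apply: dw; rewrite xs.
  - apply: continuous_in_subspaceT => s; rewrite inE/= in_itv/= => /dw ds.
    by apply: differentiable_continuous; apply/derivable1_diffP; case: ds.
  rewrite in_itv/= => /andP[/ltW xc /ltW cy] ->.
  have [c_ab _] := in_ab c (introT andP (conj xc cy)).
  rewrite normrM [`|y - x|]gtr0_norm ?subr_gt0//.
  have yx : y - x <= alpha.
    rewrite lerBlDr (le_trans yb)// (le_trans (ltW ba))// lerDl.
    by rewrite (le_trans (ltW a0)).
  have yx0 : 0 < y - x by rewrite subr_gt0.
  have -> : d = d / alpha * alpha by rewrite divfK// gt_eqF.
  apply: lt_le_trans (_ : d / alpha * (y - x) <= _).
    by rewrite ltr_pM2r// close_e.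
  by rewrite ler_pM2l.
have [th|ht|->] := ltgtP t h.
- have := w_step t h; rewrite /a /b (min_idPl (ltW th)) (max_idPr (ltW th)).
  by rewrite wh sub0r normrN => ->.
- have := w_step h t; rewrite /a /b (min_idPr (ltW ht)) (max_idPl (ltW ht)).
  by rewrite wh subr0 => ->.
- by rewrite -/(w h) wh normr0.
Unshelve. all: by end_near. Qed.

End regularisation.

(** * Integrals of continuous functions over the unit interval *)

Definition primitive_on_unit (R : realType) (h G : R -> R) : Prop :=
  forall x : R, 0 <= x <= 1 -> is_derive x 1 G (h x).

Section unit_integral.
Context {R : realType}.
Implicit Types h G : R -> R.

Lemma unit_integral_primitive h : continuous h ->
  exists2 G, primitive_on_unit h G &
    \int[@lebesgue_measure R]_(x in `]0, 1[) h x = G 1 - G 0.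
Proof.
move=> h_cont; pose mu := @lebesgue_measure R.
have h_int : mu.-integrable `[-1, 2] (EFin \o h).
  apply: continuous_compact_integrable; first exact: segment_compact.
  exact: continuous_subspaceT.
(* starting the primitive to the left of 0 makes it differentiable at 0 *)
exists (fun y => \int[mu]_(t in `[-1, y]) h t) => [x /andP[x0 x1]|].
  have x2 : x < 2 by apply: le_lt_trans x1 _; rewrite ltr1n.
  have x_1 : -1 < x by apply: lt_le_trans x0; rewrite ltrN10.
  have [dG <-] := continuous_FTC1_closed x2 h_int x_1 (h_cont x).
  by rewrite derive1E; exact: derivableP.
have h_sub (i : interval R) : {subset i <= `[-1, 1]%R} ->
    mu.-integrable [set` i] (EFin \o h).
  move=> i_sub; apply: integrableS h_int => // x /= /i_sub.
  rewrite !in_itv/= => /andP[-> x1] /=.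
  by apply: le_trans x1 _; rewrite ler1n.
rewrite Rintegral_itvB ?bnd_simp//; last exact: h_sub.
rewrite -Rintegral_itv_bndo_bndc//; apply: h_sub => x.
by rewrite !in_itv/= => /andP[x0 /ltW ->]; rewrite (le_trans _ (ltW x0)) ?lerN10.
Qed.

Lemma primitive_MVT h G x y : primitive_on_unit h G ->
  0 <= x -> x < y -> y <= 1 ->
  exists2 c, x < c < y & G y - G x = h c * (y - x).
Proof.
move=> hG x0 xy y1.
have in01 z : x <= z <= y -> 0 <= z <= 1.
  by move=> /andP[xz zy]; rewrite (le_trans x0 xz) (le_trans zy y1).
have [||c c_in ->] := @MVT R G h x y xy.
- move=> z; rewrite in_itv/= => /andP[/ltW xz /ltW zy].
  by apply: hG; rewrite in01 ?xz.
- apply: continuous_in_subspaceT => z; rewrite inE/= in_itv/= => z_in.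
  apply: differentiable_continuous; apply/derivable1_diffP.
  by case: (hG z (in01 z z_in)).
by exists c => //; move: c_in; rewrite in_itv.
Qed.

Lemma primitiveB h1 h2 G1 G2 :
  primitive_on_unit h1 G1 -> primitive_on_unit h2 G2 ->
  primitive_on_unit (fun x => h1 x - h2 x) (fun x => G1 x - G2 x).
Proof.
by move=> d1 d2 x x_in; have := d1 x x_in; have := d2 x x_in => ? ?; exact: is_deriveB.
Qed.

(** The midpoint rule is exact up to the oscillation over one cell: on each cell
    the increment of the primitive is the value at some point of the cell times
    the width. *)
Lemma midpoint_rule h (N : nat) (d : R) : (0 < N)%N -> continuous h ->
  (forall x y : R, 0 <= x <= 1 -> 0 <= y <= 1 -> `|x - y| <= dx R N ->
    `|h x - h y| <= d) ->
  `|dx R N * \sum_(i < N) h (xc R i) -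
    \int[@lebesgue_measure R]_(x in `]0, 1[) h x| <= d.
Proof.
move=> N0 h_cont osc; have [G hG ->] := unit_integral_primitive h_cont.
have NR0 : 0 < N%:R :> R by rewrite ltr0n.
have dx0 : 0 < dx R N by rewrite invr_gt0.
pose x_ (k : nat) : R := k%:R * dx R N.
have G_sum : G 1 - G 0 = \sum_(i < N) (G (x_ i.+1) - G (x_ i)).
  rewrite -(big_mkord xpredT (fun k => G (x_ k.+1) - G (x_ k))) telescope_sumr//.
  by rewrite /x_ mul0r /dx divff// gt_eqF.
rewrite G_sum mulr_sumr -sumrB (le_trans (ler_norm_sum _ _ _))//.
have -> : d = \sum_(i < N) dx R N * d.
  by rewrite sumr_const card_ord -mulr_natl mulrA /dx divff ?mul1r// gt_eqF.
apply: ler_sum => i _.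
have xi0 : 0 <= x_ i by rewrite mulr_ge0// ltW.
have xiS : x_ i.+1 = x_ i + dx R N by rewrite /x_ -natr1 mulrDl mul1r.
have xi_lt : x_ i < x_ i.+1 by rewrite xiS ltrDl.
have xi1 : x_ i.+1 <= 1 by rewrite /x_ ler_pdivrMr// mul1r ler_nat.
have [c /andP[xic cxi] ->] := primitive_MVT hG xi0 xi_lt xi1.
have -> : x_ i.+1 - x_ i = dx R N by rewrite xiS addrC addKr.
rewrite [h c * _]mulrC -mulrBr normrM gtr0_norm// ler_pM2l//.
have xcE : xc R i = x_ i + dx R N / 2 by rewrite /xc mulrDl [2^-1 * _]mulrC.
rewrite xiS in cxi xi1.
apply: osc.
- by have /andP[/ltW -> /ltW ->] := xc_itv R i.
- by rewrite (le_trans xi0 (ltW xic)) (le_trans (ltW cxi)).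
- by rewrite xcE ler_norml; apply/andP; split; lra.
Qed.

End unit_integral.

(** * The level of the continuous problem *)

Section level_cont.
Context {R : realType} {alpha : R} {U V : R -> R}.
Hypotheses (alpha_gt0 : 0 < alpha) (U1 : Ck_cc 1 0 alpha U).
Hypothesis U3 : Ck_oo 3 0 alpha U.
Let p := deriv_cc 0 alpha U.
Let T := T_inv alpha U.
Hypothesis p_incr : forall s t, 0 <= s -> s < t -> t <= alpha -> p s < p t.
Hypothesis V_ge0 : forall x, 0 <= x <= 1 -> 0 <= V x.
Hypothesis V1 : exists2 k, (0 < k)%N & Ck_cc k 0 1 V.
Context {M : R}.
Hypothesis M_in : 0 < M < alpha.

Let qT : inverse_pair alpha p T.
Proof. exact: inverse_pair_T_inv. Qed.

Let p_cont : continuous p.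
Proof. exact: (continuous_deriv_cc alpha_gt0 (ltn0Sn 0) U1). Qed.

Let T_ge0 z : 0 <= T z. Proof. by case/andP: (qT.1 z). Qed.
Let T_le z : T z <= alpha. Proof. by case/andP: (qT.1 z). Qed.

(** U' o T is the truncation to the range of U', which contracts distances. *)
Lemma T_inv_gap z w : T z < T w -> p (T w) - p (T z) <= w - z.
Proof.
rewrite /T; case: (T_invP alpha_gt0 U1 p_incr z) => [pz|zp|s s_in <-];
  case: (T_invP alpha_gt0 U1 p_incr w) => [pw|wp|t t_in <-] //= st;
  rewrite -/p; try by rewrite ?ltxx in st.
- by have := lt_trans st alpha_gt0; rewrite ltxx.
- by have := lt_trans st (proj2 (andP t_in)); rewrite ltxx.
- exact: lerB.
- by rewrite lerB.
- by rewrite lerB.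
- by have := lt_trans st (proj1 (andP s_in)); rewrite ltxx.
Qed.

(** The increments of U' over steps of length e have a positive minimum, which
    bounds from below the increments of the argument over which T grows by e. *)
Lemma T_inv_unif e : 0 < e ->
  exists2 d, 0 < d & forall z w, `|z - w| < d -> `|T z - T w| <= e.
Proof.
move=> e0; have [ea|ae] := leP alpha e.
  exists 1 => // z w _; rewrite ler_norml.
  by have := (T_ge0 z, T_le z, T_ge0 w, T_le w) => -[[[]]] *; apply/andP; split; lra.
have ae0 : 0 <= alpha - e by rewrite subr_ge0 ltW.
have incr_cont : {within `[0, alpha - e], continuous (fun s => p (s + e) - p s)}.
  apply: continuous_subspaceT => s; apply: cvgB; last exact: p_cont.
  apply: (@cvg_comp _ _ _ (fun s => s + e) p); last exact: p_cont.
  by apply: cvgD; [exact: cvg_id|exact: cvg_cst].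
have [c] := EVT_min ae0 incr_cont.
rewrite in_itv/= => /andP[c0 ca] c_min.
exists (p (c + e) - p c) => [|z w].
  by rewrite subr_gt0 p_incr ?ltrDl// -lerBrDr.
wlog zw : z w / T z <= T w.
  move=> wl zw; have [h|/ltW h] := leP (T z) (T w); first exact: wl.
  by rewrite distrC; apply: wl => //; rewrite distrC.
move=> zw_d; rewrite distrC ger0_norm ?subr_ge0// leNgt; apply/negP => big.
have Tzw : T z < T w by rewrite -subr_gt0 (lt_trans e0).
have Tze : T z + e <= T w by lra.
have Tz_in : T z \in `[0, alpha - e]%R.
  by rewrite in_itv/= T_ge0/= lerBrDr (le_trans Tze).
have pmono : p (T z + e) <= p (T w).
  have := Tze; rewrite le_eqVlt => /predU1P[->//|lt].
  by apply/ltW/p_incr => //; rewrite addr_ge0// ltW.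
have := c_min _ Tz_in; have := T_inv_gap Tzw.
have := ler_norm (w - z); rewrite distrC in zw_d; lra.
Qed.

Let V_ext := V \o clamp 0 1.

Let h (C x : R) : R := T (C - V_ext x).

Let hE C x : 0 <= x <= 1 -> h C x = T (C - V x).
Proof. by move=> x_in; rewrite /h /V_ext /= clamp_id. Qed.

Let h_cont C : continuous (h C).
Proof.
have [k _ [_ V_cont _]] := V1.
move=> x; apply: (@cvg_comp _ _ _ (fun x => C - V_ext x) T).
  apply: cvgB; first exact: cvg_cst.
  exact: (continuous_comp_clamp ler01 V_cont).
exact: (continuous_inverse qT).
Qed.

Definition mass_cont (C : R) : R :=
  \int[@lebesgue_measure R]_(x in `]0, 1[) T_inv alpha U (C - V x).

Lemma mass_contE C :
  mass_cont C = \int[@lebesgue_measure R]_(x in `]0, 1[) h C x.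
Proof.
apply: eq_Rintegral => x; rewrite inE/= in_itv/= => /andP[/ltW x0 /ltW x1].
by rewrite hE// x0.
Qed.

Lemma mass_cont_primitive C :
  exists2 G, primitive_on_unit (h C) G & mass_cont C = G 1 - G 0.
Proof.
have [G hG E] := unit_integral_primitive (@h_cont C).
by exists G => //; rewrite mass_contE.
Qed.

(** The mean value theorem reduces statements on masses to statements on densities
    at a single point. *)
Lemma mass_cont_mean C :
  exists2 x, 0 < x < 1 & mass_cont C = T (C - V x).
Proof.
have [G hG ->] := mass_cont_primitive C.
have [x x_in ->] := primitive_MVT hG (lexx 0) ltr01 (lexx 1).
by exists x => //; rewrite subr0 mulr1 hE//; case/andP: x_in => /ltW -> /ltW ->.
Qed.

Lemma mass_contB_mean C C' : exists2 x, 0 < x < 1 &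
  mass_cont C - mass_cont C' = T (C - V x) - T (C' - V x).
Proof.
have [G hG ->] := mass_cont_primitive C; have [G' hG' ->] := mass_cont_primitive C'.
have [x x_in] := primitive_MVT (primitiveB hG hG') (lexx 0) ltr01 (lexx 1).
rewrite subr0 mulr1 !hE; [|by case/andP: x_in => /ltW -> /ltW ->..].
by move=> E; exists x => //; rewrite -E; ring.
Qed.

Lemma mass_cont_homo C C' : C <= C' -> mass_cont C <= mass_cont C'.
Proof.
move=> CC'; have [x _ E] := mass_contB_mean C' C.
by rewrite -subr_ge0 E subr_ge0 (inverse_homo qT)// lerD2r.
Qed.

Lemma continuous_mass_cont : continuous mass_cont.
Proof.
move=> C; apply/cvgrPdist_le => e e0; have [d d0 Td] := T_inv_unif e0.
have close : \forall C' \near C, `|C - C'| < d by exact: nbhsx_ballx.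
apply: (filterS (F := nbhs C)) close => C' CC'.
have [x _ ->] := mass_contB_mean C C'; apply: Td.
by have -> : C - V x - (C' - V x) = C - C' by ring.
Qed.

Let V_lip : exists2 L : R, 0 < L & forall x y, 0 <= x <= 1 -> 0 <= y <= 1 ->
  `|V y - V x| <= L * `|y - x|.
Proof. by have [k k0 Vk] := V1; exact: (Ck_cc_lipschitz ltr01 k0 Vk). Qed.

Lemma V_bounded : exists2 W : R, 0 <= W & forall x, 0 <= x <= 1 -> V x <= W.
Proof.
have [L L0 VL] := V_lip; have in0 : 0 <= (0 : R) <= 1 by rewrite lexx ler01.
exists (V 0 + L) => [|x x_in]; first by rewrite addr_ge0 ?V_ge0// ltW.
have := VL _ _ in0 x_in; rewrite subr0 => Vx0; have /andP[x0 x1] := x_in.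
have : L * `|x| <= L by rewrite ger0_norm// ler_piMr// ltW.
have := ler_norm (V x - V 0); lra.
Qed.

Lemma mass_cont_exists : exists C, mass_cont C = M.
Proof.
have [W W0 VW] := V_bounded.
have low : mass_cont (p M) <= M.
  have [x /andP[/ltW x0 /ltW x1] ->] := mass_cont_mean (p M).
  by rewrite -{2}(inverseK qT M_in) (inverse_homo qT)// gerBl V_ge0// x0.
have high : M <= mass_cont (p M + W).
  have [x /andP[/ltW x0 /ltW x1] ->] := mass_cont_mean (p M + W).
  rewrite -{1}(inverseK qT M_in) (inverse_homo qT)// -addrA lerDl subr_ge0.
  by rewrite VW// x0.
have pW : p M <= p M + W by rewrite lerDl.
have lh := le_trans low high.
have [|C _ <-] := IVT (v := M) pW (continuous_subspaceT continuous_mass_cont).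
  by rewrite (min_idPl lh) (max_idPr lh) low.
by exists C.
Qed.

(** U'' is bounded near the interior point M, so T has a positive minimal slope
    around U'(M). *)
Lemma T_inv_slope : exists B r : R, [/\ 0 < B, 0 < r &
  forall z w, p M - r <= z -> z <= w -> w <= p M + r ->
    w - z <= B * (T w - T z)].
Proof.
have /andP[M0 Ma] := M_in.
pose a := M / 2; pose b := (M + alpha) / 2.
have a0 : 0 < a by rewrite divr_gt0.
have aM : a < M by rewrite ltr_pdivrMr// ltr_pMr// ltr1n.
have [Mb ba] : M < b /\ b < alpha by split; [exact: (midf_lt Ma).1|exact: (midf_lt Ma).2].
have in_ab s : a <= s <= b -> 0 < s < alpha.
  by move=> /andP[as_ sb]; rewrite (lt_le_trans a0 as_) (le_lt_trans sb ba).
have ab : a <= b by rewrite ltW// (lt_trans aM).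
have U2_cont : {within `[a, b], continuous (fun s => (U^`(2))%classic s)}.
  apply: continuous_in_subspaceT => s; rewrite inE/= in_itv/= => /in_ab s_in.
  exact: (Ck_oo_continuous U3 (ltnSn 2)).
have [c _ c_max] := EVT_max ab U2_cont.
pose B := Num.max 1 ((U^`(2))%classic c).
have B0 : 0 < B by rewrite lt_max ltr01.
have paM : p a < p M by apply: p_incr; rewrite ?ltW.
have pMb : p M < p b by apply: p_incr; rewrite ?ltW.
exists B, (Num.min (p M - p a) (p b - p M)); split => //.
  by rewrite lt_min !subr_gt0 paM.
move=> z w rz zw wr; set r := Num.min _ _ in rz wr.
have raz : r <= p M - p a by rewrite ge_min lexx.
have rbw : r <= p b - p M by rewrite ge_min lexx orbT.
have paz : p a <= z by lra.
have wpb : w <= p b by lra.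
have a_in : 0 < a < alpha by rewrite a0 (lt_trans aM Ma).
have b_in : 0 < b < alpha by rewrite ba (lt_trans M0 Mb).
have T_ab y : p a <= y <= p b -> a <= T y <= b.
  move=> /andP[ay yb]; rewrite -{1}(inverseK qT a_in) -{1}(inverseK qT b_in).
  by rewrite !(inverse_homo qT).
have Tz := T_ab z (introT andP (conj paz (le_trans zw wpb))).
have Tw := T_ab w (introT andP (conj (le_trans paz zw) wpb)).
have := inverse_homo qT zw; rewrite le_eqVlt => /predU1P[Tzw|Tzw].
  have /eqP := congr1 p Tzw; rewrite (inverse_root qT (in_ab _ Tz)).
  rewrite (inverse_root qT (in_ab _ Tw)) => /eqP ->.
  by rewrite subrr mulr_ge0 ?subr_ge0 ?Tzw// ltW.
have /andP[aTz _] := Tz; have /andP[_ Twb] := Tw.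
have [s /andP[zs sw]] := deriv_cc_MVT alpha_gt0 U1 U3 (T_ge0 z) Tzw (T_le w).
rewrite -/p (inverse_root qT (in_ab _ Tz)) (inverse_root qT (in_ab _ Tw)) => ->.
rewrite ler_pM2r ?subr_gt0// le_max c_max ?orbT// in_itv/=.
by rewrite (le_trans aTz (ltW zs)) (le_trans (ltW sw) Twb).
Qed.

(** By the mean value theorem the density at level C0 equals M at some point of
    (0,1).  Around this point the density grows at least linearly with the level,
    as long as the level stays close to C0; further away the monotonicity of the
    mass preserves what has been gained. *)
Lemma mass_cont_growth C0 : mass_cont C0 = M ->
  exists k r : R, [/\ 0 < k, 0 < r &
    forall C, k * Num.min `|C - C0| r <= `|mass_cont C - M|].
Proof.
move=> C0M.
have [x0 x0_in] := mass_cont_mean C0; rewrite C0M => TM.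
have pM : p M = C0 - V x0 by rewrite TM (inverse_root qT)// -TM.
have [B [d [B0 d0 slope]]] := T_inv_slope.
have [L L0 VL] := V_lip.
have /andP[x00 x01] := x0_in.
have d20 : 0 < d / 2 by rewrite divr_gt0.
pose y0 := Num.min 1 (x0 + d / 2 / L).
have xy : x0 < y0 by rewrite lt_min x01 ltrDl divr_gt0.
have y01 : y0 <= 1 by rewrite ge_min lexx.
have V_near x : x0 <= x <= y0 -> `|V x - V x0| <= d / 2.
  move=> /andP[xx xy0]; apply: le_trans (VL _ _ _ _) _.
  - by rewrite !ltW.
  - by rewrite (le_trans (ltW x00) xx) (le_trans xy0).
  - rewrite ger0_norm ?subr_ge0// mulrC -ler_pdivlMr// lerBlDl.
    by apply: le_trans xy0 _; rewrite ge_min lexx orbT.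
pose k := (y0 - x0) / B.
have k0 : 0 < k by rewrite divr_gt0// subr_gt0.
(* the points between x0 and y0 give the linear growth, all others contribute
   with the right sign *)
have step C C' : C <= C' -> `|C - C0| <= d / 2 -> `|C' - C0| <= d / 2 ->
    k * (C' - C) <= mass_cont C' - mass_cont C.
  move=> CC' Cd C'd.
  have [G hG ->] := mass_cont_primitive C.
  have [G' hG' ->] := mass_cont_primitive C'.
  pose W x := G' x - G x.
  have WG : primitive_on_unit (fun x => h C' x - h C x) W by exact: primitiveB.
  have W_homo x y : 0 <= x -> x <= y -> y <= 1 -> W x <= W y.
    move=> x_ge0; rewrite le_eqVlt => /predU1P[->//|lt_xy] y1.
    have [c _ E] := primitive_MVT WG x_ge0 lt_xy y1.
    rewrite -subr_ge0 E mulr_ge0 ?subr_ge0 ?(ltW lt_xy)//.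
    by rewrite (inverse_homo qT)// lerD2r.
  have mid : k * (C' - C) <= W y0 - W x0.
    have [c /andP[x0c cy0] ->] := primitive_MVT WG (ltW x00) xy y01.
    rewrite /k mulrAC ler_pdivrMr// [leRHS]mulrAC [leRHS]mulrC.
    rewrite ler_pM2l ?subr_gt0// mulrC.
    have c_in : 0 <= c <= 1.
      by rewrite (le_trans (ltW x00) (ltW x0c)) (le_trans (ltW cy0)).
    have := V_near c (introT andP (conj (ltW x0c) (ltW cy0))).
    move: Cd C'd; rewrite !ler_norml => /andP[? ?] /andP[? ?] /andP[? ?].
    rewrite !hE//.
    have -> : C' - C = (C' - V c) - (C - V c) by ring.
    by apply: slope; rewrite ?pM; lra.
  have W0 := W_homo 0 x0 (lexx 0) (ltW x00) (ltW x01).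
  have W1 := W_homo y0 1 (le_trans (ltW x00) (ltW xy)) y01 (lexx 1).
  have -> : G' 1 - G' 0 - (G 1 - G 0) = W 1 - W 0 by rewrite /W; ring.
  lra.
exists k, (d / 2); split => // C.
have zero_d : `|C0 - C0| <= d / 2 by rewrite subrr normr0 ltW.
have [CC0|/ltW CC0] := leP C0 C.
  rewrite [`|C - C0|]ger0_norm ?subr_ge0//.
  rewrite ger0_norm; last by rewrite subr_ge0 -C0M mass_cont_homo.
  pose e := Num.min (C - C0) (d / 2).
  have e0 : 0 <= e by rewrite le_min subr_ge0 CC0 ltW.
  have ed : e <= d / 2 by rewrite ge_min lexx orbT.
  have eC : C0 + e <= C by rewrite -lerBrDl ge_min lexx.
  have := step C0 (C0 + e); have -> : C0 + e - C0 = e by ring.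
  rewrite lerDl e0 (ger0_norm e0).
  move=> /(_ isT zero_d ed); rewrite C0M => /le_trans; apply.
  by rewrite lerD2r mass_cont_homo.
rewrite distrC [`|C0 - C|]ger0_norm ?subr_ge0//.
rewrite distrC ger0_norm; last by rewrite subr_ge0 -C0M mass_cont_homo.
pose e := Num.min (C0 - C) (d / 2).
have e0 : 0 <= e by rewrite le_min subr_ge0 CC0 ltW.
have ed : e <= d / 2 by rewrite ge_min lexx orbT.
have eC : C <= C0 - e by rewrite lerBrDl -lerBrDr ge_min lexx.
have sub_e : `|C0 - e - C0| <= d / 2.
  have -> : C0 - e - C0 = - e by ring.
  by rewrite normrN (ger0_norm e0).
have := step (C0 - e) C0; rewrite gerBl e0 => /(_ isT sub_e zero_d).
have -> : C0 - (C0 - e) = e by ring.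
rewrite C0M => /le_trans; apply.
by rewrite lerD2l lerN2 mass_cont_homo.
Qed.

Lemma mass_cont_unique C C' : mass_cont C = M -> mass_cont C' = M -> C = C'.
Proof.
move=> CM C'M; have [k [r [k0 r0 grow]]] := mass_cont_growth CM.
have := grow C'; rewrite C'M subrr normr0 pmulr_rle0// ge_min (leNgt r) r0 orbF.
by rewrite normr_le0 subr_eq0 => /eqP.
Qed.

(** * The discrete levels approximate the continuous one *)

Lemma level_mass_error (N : nat) C (e : R) : (0 < N)%N ->
  (forall x y, 0 <= x <= 1 -> 0 <= y <= 1 -> `|x - y| <= dx R N ->
    `|T (C - V x) - T (C - V y)| <= e) ->
  has_mass M (rho_eq alpha U V N C) -> `|mass_cont C - M| <= e.
Proof.
move=> N0 osc massC; rewrite distrC -massC mass_contE.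
under eq_bigr => i _.
  rewrite mxE -/T -hE; last by have /andP[/ltW -> /ltW ->] := xc_itv R i.
  over.
by apply: midpoint_rule => // x y x_in y_in xy; rewrite !hE// osc.
Qed.

(** A midpoint error below the growth over the distance e keeps the level within
    e of C0. *)
Lemma level_cvg C0 (C0D : nat -> R) : mass_cont C0 = M ->
  (forall N, (0 < N)%N -> has_mass M (rho_eq alpha U V N (C0D N))) ->
  C0D N @[N --> \oo] --> C0.
Proof.
move=> C0M massD; have [k [r [k0 r0 grow]]] := mass_cont_growth C0M.
have [L L0 VL] := V_lip.
apply/cvgrPdist_lt => e e0.
have er0 : 0 < Num.min e r by rewrite lt_min e0.
have q0 : 0 < k * Num.min e r / 2 by rewrite divr_gt0// mulr_gt0.
have [d d0 Td] := T_inv_unif q0.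
near=> N.
have N0 : (0 < N)%N by near: N; exact: nbhs_infty_gt.
have LN : L / d < N%:R by near: N; exact: nbhs_infty_gtr.
have NR0 : 0 < N%:R :> R by rewrite ltr0n.
have err : `|mass_cont (C0D N) - M| <= k * Num.min e r / 2.
  apply: level_mass_error (massD N N0) => // x y x_in y_in xy; apply: Td.
  have -> : C0D N - V x - (C0D N - V y) = V y - V x by ring.
  apply: le_lt_trans (VL _ _ x_in y_in) _.
  apply: (@le_lt_trans _ _ (L * dx R N)); first by rewrite ler_pM2l// distrC.
  by rewrite /dx ltr_pdivrMr// mulrC -ltr_pdivrMr.
have := le_trans (grow (C0D N)) err; rewrite -mulrA ler_pM2l// => small.
rewrite distrC ltNge; apply/negP => big.
have : Num.min e r <= Num.min `|C0D N - C0| r.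
  by rewrite le_min !ge_min big lexx orbT.
lra.
Unshelve. all: by end_near. Qed.

Lemma T_inv_lipschitz c : 0 < c ->
  (forall s, 0 < s < alpha -> c <= (U^`(2))%classic s) ->
  forall z w, `|T z - T w| <= c^-1 * `|z - w|.
Proof.
move=> c0 U2c z w.
wlog zw : z w / T z <= T w.
  move=> wl; have [le|/ltW le] := leP (T z) (T w); first exact: wl.
  by rewrite distrC [`|z - w|]distrC; exact: wl.
rewrite distrC [`|z - w|]distrC ger0_norm ?subr_ge0//.
move: zw; rewrite le_eqVlt => /predU1P[->|zw].
  by rewrite subrr mulr_ge0 ?invr_ge0 ?(ltW c0).
rewrite mulrC ler_pdivlMr// (le_trans _ (ler_norm _))//.
apply: le_trans (T_inv_gap zw).
have [s /andP[zs sw]] := deriv_cc_MVT alpha_gt0 U1 U3 (T_ge0 z) zw (T_le w).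
rewrite -/p => ->; rewrite mulrC ler_pM2r ?subr_gt0// U2c//.
by rewrite (le_lt_trans (T_ge0 z) zs) (lt_le_trans sw (T_le w)).
Qed.

(** Beyond these bounds all cells lie strictly on one side of M. *)
Lemma level_bounds (N : nat) C W : (0 < N)%N ->
  (forall x, 0 <= x <= 1 -> V x <= W) ->
  has_mass M (rho_eq alpha U V N C) -> p M <= C <= p M + W.
Proof.
move=> N0 VW /(has_mass_row N0) massC.
have sumM : \sum_(i < N) M = N%:R * M by rewrite sumr_const card_ord mulr_natl.
have sum_lt (f g : 'I_N -> R) : (forall i, f i < g i) -> \sum_i f i < \sum_i g i.
  case: N N0 f g {massC sumM} => // n _ f g fg; apply: ltr_sum => //.
  by apply/hasP; exists ord0 => //; exact: mem_index_enum.
have xc01 (i : 'I_N) : 0 <= xc R i <= 1 by have /andP[/ltW -> /ltW ->] := xc_itv R i.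
apply/andP; split; rewrite leNgt; apply/negP => out.
  have : \sum_i rho_eq alpha U V N C 0 i < \sum_(i < N) M.
    apply: sum_lt => i; rewrite mxE; have [-> _] := qT.2 _ (C - V (xc R i)) M_in.
    by apply: le_lt_trans out; rewrite gerBl V_ge0.
  by rewrite massC sumM ltxx.
have : \sum_(i < N) M < \sum_i rho_eq alpha U V N C 0 i.
  apply: sum_lt => i; rewrite mxE; have [_ ->] := qT.2 _ (C - V (xc R i)) M_in.
  by rewrite ltrBrDr (le_lt_trans _ out)// lerD2l VW.
by rewrite massC sumM ltxx.
Qed.

(** For levels close to C0 the linear growth of the mass turns the O(dx) error of
    the midpoint rule into an O(dx) error of the level; at a distance r or more from
    C0 the error is bounded below, while all levels stay in a bounded interval.
    Finally dx <= dx^gamma, as dx <= 1. *)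
Lemma level_rate C0 gamma c : mass_cont C0 = M -> 0 < gamma <= 1 -> 0 < c ->
  (forall s, 0 < s < alpha -> c <= (U^`(2))%classic s) ->
  exists K : R, forall (N : nat) C, (0 < N)%N ->
    has_mass M (rho_eq alpha U V N C) -> `|C - C0| <= K * dx R N `^ gamma.
Proof.
move=> C0M /andP[g0 g1] c0 U2c.
have [k [r [k0 r0 grow]]] := mass_cont_growth C0M.
have [L L0 VL] := V_lip; have [W W0 VW] := V_bounded.
have T_lip := T_inv_lipschitz c0 U2c.
have C0_bounds : p M <= C0 <= p M + W.
  have [x x_in] := mass_cont_mean C0; rewrite C0M => TM.
  have -> : p M = C0 - V x by rewrite TM (inverse_root qT)// -TM.
  have x_in' : 0 <= x <= 1 by case/andP: x_in => /ltW -> /ltW ->.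
  by rewrite gerBl V_ge0//= -addrA lerDl addrC subr_ge0 VW.
pose q := L / c / k.
have q0 : 0 < q by rewrite !divr_gt0.
exists (q * (1 + W / r)) => N C N0 massC.
have dx0 : 0 < dx R N by rewrite invr_gt0 ltr0n.
have dx1 : dx R N <= 1 by rewrite invf_le1 ?ltr0n// ler1n.
have err : `|mass_cont C - M| <= L / c * dx R N.
  apply: level_mass_error massC => // x y x_in y_in xy.
  apply: le_trans (T_lip _ _) _.
  have -> : C - V x - (C - V y) = V y - V x by ring.
  rewrite [L / c]mulrC -mulrA ler_pM2l ?invr_gt0//.
  by rewrite (le_trans (VL _ _ x_in y_in))// ler_pM2l// distrC.
have small : Num.min `|C - C0| r <= q * dx R N.
  rewrite /q mulrAC ler_pdivlMr// mulrC.
  exact: le_trans (grow C) err.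
have dist_W : `|C - C0| <= W.
  have /andP[? ?] := level_bounds N0 VW massC; have /andP[? ?] := C0_bounds.
  by rewrite ler_norml; apply/andP; split; lra.
have dxg : dx R N <= dx R N `^ gamma.
  have dx01 : 0 < dx R N <= 1 by rewrite dx0.
  by have := ger_powR dx01 g1; rewrite powRr1// ltW.
apply: (@le_trans _ _ (q * (1 + W / r) * dx R N)); last first.
  by rewrite ler_pM2l// mulr_gt0// ltr_wpDr// divr_ge0// ltW.
have qdx0 : 0 <= q * dx R N by rewrite mulr_ge0// ltW.
rewrite mulrAC mulrDr mulr1.
have [le|lt] := leP `|C - C0| r.
  rewrite (min_idPl le) in small.
  by rewrite (le_trans small)// lerDl mulr_ge0// divr_ge0// ltW.
rewrite (min_idPr (ltW lt)) in small.
apply: (le_trans dist_W); apply: (@le_trans _ _ (q * dx R N * (W / r))); last first.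
  by rewrite lerDr.
rewrite mulrCA; apply: ler_peMr => //.
by rewrite ler_pdivlMr// mul1r.
Qed.

End level_cont.

Theorem theorem2p16 (R : realType) (alpha : R) (m V U : R -> R) (s0 : R)
    (m1 m2 : R -> R)
    (Hst : standing alpha m V U s0)
    (Hmd : mobility_decomposition alpha m m1 m2)
    (HU : Ck_cc 1 0 alpha U) :
  (forall (N : nat) (dt : R), (0 < N)%N -> 0 < dt ->
     (* (i) *)
     (forall rho : 'rV[R]_N, admissible alpha rho ->
        cvg (iter n (J alpha m1 m2 U V dt) rho @[n --> \oo]) /\
        J alpha m1 m2 U V dt (Jinf alpha m1 m2 U V dt rho) =
          Jinf alpha m1 m2 U V dt rho) /\
     (* (ii) *)
     (forall rho eta : 'rV[R]_N, admissible alpha rho -> admissible alpha eta ->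
        l1norm (Jinf alpha m1 m2 U V dt rho - Jinf alpha m1 m2 U V dt eta)
          <= l1norm (rho - eta))) /\
  ({ae @lebesgue_measure R, forall s : R, 0 < s < alpha -> 0 < (U^`(2)) s} ->
   forall M : R, 0 < M < alpha ->
     (forall N : nat, (0 < N)%N ->
        (exists C0D : R, has_mass M (rho_eq alpha U V N C0D)) /\
        forall C0D : R, has_mass M (rho_eq alpha U V N C0D) ->
          (* (iii) *)
          (forall dt : R, 0 < dt ->
             J alpha m1 m2 U V dt (rho_eq alpha U V N C0D) =
               rho_eq alpha U V N C0D /\
             Jinf alpha m1 m2 U V dt (rho_eq alpha U V N C0D) =
               rho_eq alpha U V N C0D) /\
          (* (iv) *)
          (forall (kappa : R -> R) (Phie me Ue : R -> R -> R),
             regularisation alpha m U s0 kappa Phie me Ue ->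
             (forall e : R, 0 < e <= 1 ->
                exists! CeD : R, has_mass M (rho_eq_eps alpha Ue V N e CeD)) /\
             forall CeD : R -> R,
               (forall e : R, 0 < e <= 1 ->
                  has_mass M (rho_eq_eps alpha Ue V N e (CeD e))) ->
               rho_eq_eps alpha Ue V N e (CeD e) @[e --> 0^'+]
                 --> rho_eq alpha U V N C0D)) /\
     (* (v) *)
     (exists! C0 : R, has_mass_cont alpha U V M C0) /\
     forall C0 : R, has_mass_cont alpha U V M C0 ->
       (forall C0D : nat -> R,
          (forall N, (0 < N)%N -> has_mass M (rho_eq alpha U V N (C0D N))) ->
          C0D N @[N --> \oo] --> C0) /\
       (forall gamma : R, 0 < gamma <= 1 ->
          0 < inf (U^`(2) @` `]0, alpha[) ->
          holder_on gamma (deriv_cc 0 alpha U 0) (deriv_cc 0 alpha U alpha)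
            (deriv_inv_cc alpha U) ->
          exists K : R, forall (N : nat) (C0D : R), (0 < N)%N ->
            has_mass M (rho_eq alpha U V N C0D) ->
            `|C0D - C0| <= K * dx R N `^ gamma)).
Proof.
have alpha_gt0 := st_alpha Hst; have U3 := st_U_C3 Hst.
have m_pos := st_m_pos Hst; have U_convex := st_U_convex Hst.
have m_0 := st_m_0 Hst; have m_alpha := st_m_alpha Hst.
split=> [N dt N0 dt0|U2_pos M M_in].
  split=> [rho ar|rho eta ar ae].
    have [cvJ fixJ] := Jinf_cvg (V := V) alpha_gt0 m_0 m_alpha m_pos Hmd HU U3 U_convex
      N0 dt0 ar.
    by split=> //; apply/cvg_ex; exists (Jinf alpha m1 m2 U V dt rho).
  exact: (Jinf_contraction (V := V) alpha_gt0 m_0 m_alpha m_pos Hmd HU U3 U_convex).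
have p_incr := deriv_cc_strict alpha_gt0 HU U3 U_convex U2_pos.
have qT := inverse_pair_T_inv alpha_gt0 HU p_incr.
have V_ge0 := st_V_ge0 Hst.
have V1 : exists2 k, (0 < k)%N & Ck_cc k 0 1 V by exists 2%N => //; exact: st_V_C2 Hst.
split=> [N N0|].
  split=> [|C massC]; first exact: (level_mass_exists qT V_ge0 N0 M_in).
  split=> [dt dt0|kappa Phie me Ue Hre].
    split.
      exact: (rho_eq_stationary (V := V) alpha_gt0 m_0 m_alpha m_pos Hmd HU U3).
    exact: (Jinf_rho_eq (V := V) alpha_gt0 m_0 m_alpha m_pos Hmd HU U3).
  split=> [e e_in|Ce massCe].
    have [T_in qTe] := deriv_inv_Ue Hst Hre e_in.
    have [Ce massCe] := level_mass_exists qTe V_ge0 N0 M_in.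
    exists Ce; split=> // C' massC'.
    exact: (level_mass_inj qTe N0 T_in massCe massC').
  have e_near : \forall e \near 0^'+, 0 < e <= (1 : R).
    near=> e; apply/andP; split; near: e; first exact: nbhs_right_gt.
    exact: nbhs_right_le.
  have qTe : \forall e \near 0^'+,
      inverse_pair alpha ((Ue e)^`())%classic (deriv_inv alpha (Ue e)).
    by apply: filterS e_near => e /(deriv_inv_Ue Hst Hre)[].
  have massCe' : \forall e \near 0^'+,
      has_mass M (level_row (deriv_inv alpha (Ue e)) V N (Ce e)).
    by apply: filterS e_near => e; exact: massCe.
  exact: (level_row_cvg qT qTe (fun t => Ue1_cvg Hst Hre (t := t)) N0 massC).
split=> [|C0 massC0].
  have [C0 massC0] := mass_cont_exists alpha_gt0 HU p_incr V_ge0 V1 M_in.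
  exists C0; split=> // C massC.
  exact: (mass_cont_unique alpha_gt0 HU U3 p_incr V1 M_in massC0 massC).
split=> [C0D massC0D|gamma gamma_in inf_pos _].
  exact: (level_cvg alpha_gt0 HU U3 p_incr V1 M_in massC0 massC0D).
apply: (level_rate alpha_gt0 HU U3 p_incr V_ge0 V1 M_in massC0 gamma_in inf_pos).
move=> s s_in; apply: ge_inf; last by exists s => //=; rewrite in_itv.
by exists 0 => _ [t + <-]; rewrite /= in_itv/= => /U_convex.
Unshelve. all: by end_near. Qed.
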